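(* Let $G$ be a Lie group modelled on a locally convex space $F$, and $r\in\mathbb{N}_0\cup\{\infty\}$. If $r>0$, let $M$ be a locally compact, rough $C^r$-manifold. If $r=0$, let $M$ be a locally compact topological space. Then we have: (a) If $K$ and $L$ are compact subsets of $M$ such that $K\subseteq L^0$, then $$\overline{C^r_L(M,G)}\supseteq C_K(M,G)$$ holds for the closure in $C_0(M,G)$, which equals the closure in $C_L(M,G)$. (b) $C^r_c(M,G)$ is dense in $C_0(M,G)$.
   Context: ''Locally convex space'' (lcs) means a real, Hausdorff locally convex topological vector space; locally compact spaces are Hausdorff; $L^0$ is the interior of $L$ in $M$. Lie groups modelled on lcs are smooth in the sense of Bastiani calculus (continuous iterated directional derivatives of all orders); $e$ is the neutral element. For lcs $E,F$ and $R\subseteq E$ regular (interior $R^0$ dense in $R$), $f\colon R\to F$ is $C^r$ if it is continuous and for $j\in\mathbb{N}$, $j\le r$, the iterated directional derivatives $(D_{y_j}\cdots D_{y_1}f)(x)$ exist for $x\in R^0$, $y_i\in E$ and extend continuously to $R\times E^j$. A rough $C^r$-manifold is a Hausdorff space $M$ with a maximal set of homeomorphisms (charts) $\phi\colon U_\phi\to V_\phi$ from open sets covering $M$ onto regular subsets $V_\phi$ of lcs $E_\phi$ whose transition maps $\phi\circ\psi^{-1}$ are $C^r$ and take the interior of $\psi(U_\phi\cap U_\psi)$ in $E_\psi$ into the interior of $\phi(U_\phi\cap U_\psi)$ in $E_\phi$. $C^r$-maps $M\to G$ are continuous maps that are $C^r$ in charts; $C^0$ means continuous. The support of $\gamma\colon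 M\to G$ is the closure of $\{x:\gamma(x)\ne e\}$. $C^r_L(M,G)$ is the group of $C^r$-maps $M\to G$ with support in $L$, $C_K(M,G):=C^0_K(M,G)$, and $C^r_c(M,G)$ is the group of $C^r$-maps with compact support. $C_0(M,G)$ is the group of continuous maps $\gamma\colon M\to G$ vanishing at infinity: for each $e$-neighbourhood $U\subseteq G$ there is a compact $K\subseteq M$ with $\gamma(M\setminus K)\subseteq U$ (so $C_0(M,G)=C(M,G)$ if $M$ is compact). $C_0(M,G)$ is a Lie group modelled on $C_0(M,F)$ (with the topology of uniform convergence), such that for each chart $\phi\colon U\to V\subseteq F$ of $G$ with $e\in U$, $\phi(e)=0$, the set $C_0(M,U)$ of $U$-valued functions is open and $C_0(M,U)\to C_0(M,V)$, $\gamma\mapsto\phi\circ\gamma$ is a chart. $C_L(M,G)$ is a Lie group modelled on $C_L(M,F)$ with analogous charts; it is a closed submanifold of $C_0(M,G)$. *)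

(* Defs.v *)
From HB Require Import structures.
From mathcomp Require Import all_boot all_order all_algebra.
From mathcomp Require Import all_classical all_reals all_analysis.

Set Implicit Arguments.
Unset Strict Implicit.
Unset Printing Implicit Defensive.

Import Order.TTheory GRing.Theory Num.Theory.
Import numFieldNormedType.Exports.
Local Open Scope classical_set_scope.
Local Open Scope ring_scope.

(* Orders of differentiability: [Some k] is the natural number k and [None]
   is infinity. *)
Definition le_order (j : nat) (r : option nat) : bool :=
  if r is Some k then (j <= k)%N else true.

(* The library's [tvsType R] are the locally convex topological vector spaces
   over R, not assumed Hausdorff, and its 'D_v is only available for normed
   modules; hence the versions below. *)
Section Bastiani.
Context {R : realType} {E F : tvsType R}.
Implicit Types (f : E -> F) (x y : E) (D : set E).

Definition diff_quot f y x : R -> F := fun t => t^-1 *: (f (x + t *: y) - f x).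

Definition is_dderiv f y x (l : F) : Prop := diff_quot f y x @ (0 : R)^' --> l.

Definition dderivable f y x : Prop := exists l, is_dderiv f y x l.

Definition dderiv f y : E -> F := fun x => xget 0 [set l | is_dderiv f y x l].

(* [iter_dderiv f [:: y1; ...; yj]] is D_{yj} ... D_{y1} f *)
Fixpoint iter_dderiv f (ys : seq E) : E -> F :=
  if ys is y :: ys' then iter_dderiv (dderiv f y) ys' else f.

Fixpoint iter_dderivable f (ys : seq E) x : Prop :=
  if ys is y :: ys' then
    dderivable f y x /\ iter_dderivable (dderiv f y) ys' x
  else True.

Definition regular_set D : Prop := D `<=` closure D°.

(* C^r-maps on a regular set D; only the values of f on D matter. *)
Definition Cr_on (r : option nat) D f : Prop :=
  {within D, continuous f} /\
  forall j : nat, le_order j r ->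
    (forall x (ys : 'I_j -> E), D° x ->
       iter_dderivable f [seq ys i | i : 'I_j] x) /\
    exists g : E * {ptws 'I_j -> E} -> F,
      {within D `*` setT, continuous g} /\
      forall x (ys : 'I_j -> E), D° x ->
        g (x, ys) = iter_dderiv f [seq ys i | i : 'I_j] x.

End Bastiani.

(* A homeomorphism [chart_map] from an open subset [chart_dom] of X onto a
   regular subset of E; the inverse is carried along as a function on E whose
   values outside that subset are irrelevant. *)
Record chart (R : realType) (X : topologicalType) (E : tvsType R) := Chart {
  chart_dom : set X ;
  chart_map :> X -> E ;
  chart_inv : E -> X ;
  chart_dom_open : open chart_dom ;
  chart_map_continuous : {within chart_dom, continuous chart_map} ;
  chart_inv_continuous :
    {within chart_map @` chart_dom, continuous chart_inv} ;
  chart_mapK : forall x, chart_dom x -> chart_inv (chart_map x) = x ;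
  chart_regular : regular_set (chart_map @` chart_dom)
}.

Definition chart_codom (R : realType) (X : topologicalType) (E : tvsType R)
  (phi : chart X E) : set E := phi @` chart_dom phi.

(* The modelling space may vary from chart to chart. *)
Record rough_chart (R : realType) (X : topologicalType) := RoughChart {
  rough_model : tvsType R ;
  rough_model_hausdorff : hausdorff_space rough_model ;
  rough_chart_chart :> chart X rough_model
}.

Section Compatibility.
Context {R : realType} {X : topologicalType} {E1 E2 : tvsType R}.

Definition Cr_transition (r : option nat)
    (phi : chart X E1) (psi : chart X E2) : Prop :=
  let D := chart_dom phi `&` chart_dom psi in
  let tau := psi \o chart_inv phi in
  Cr_on r (phi @` D) tau /\ tau @` (phi @` D)° `<=` (psi @` D)°.

End Compatibility.

Definition is_rough_manifold (R : realType) (r : option nat)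
    (M : topologicalType) (A : rough_chart R M -> Prop) : Prop :=
  [/\ hausdorff_space M,
      forall x, exists2 phi, A phi & chart_dom phi x,
      forall phi psi : rough_chart R M, A phi -> A psi ->
        Cr_transition r phi psi &
      forall psi : rough_chart R M, (forall phi : rough_chart R M, A phi ->
        Cr_transition r phi psi /\ Cr_transition r psi phi) -> A psi].

#[short(type="topGroupType")]
HB.structure Definition TopGroup := {G of Topological G & Group G}.

(* No continuity of the group operations is built in [topGroupType]; it is
   part of the following predicate: B is a maximal smooth atlas with open
   codomains, modelled on F, turning G into a Lie group. *)
Definition is_lie_group (R : realType) (F : tvsType R) (G : topGroupType)
    (B : chart G F -> Prop) : Prop :=
  [/\ hausdorff_space G,
      [/\ forall phi, B phi -> open (chart_codom phi),
          forall x, exists2 phi, B phi & chart_dom phi x,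
          forall phi psi, B phi -> B psi -> Cr_transition None phi psi &
          forall psi, open (chart_codom psi) -> (forall phi, B phi ->
            Cr_transition None phi psi /\ Cr_transition None psi phi) ->
            B psi],
      continuous (fun xy : G * G => (xy.1 * xy.2)%g) /\
      (forall phi1 phi2 psi, B phi1 -> B phi2 -> B psi ->
        let mu := fun uv : F * F =>
          (chart_inv phi1 uv.1 * chart_inv phi2 uv.2)%g in
        Cr_on None ((chart_codom phi1 `*` chart_codom phi2) `&`
                    mu @^-1` chart_dom psi) (psi \o mu)) &
      continuous (fun x : G => (x^-1)%g) /\
      (forall phi psi, B phi -> B psi ->
        let iota := fun u : F => ((chart_inv phi u)^-1)%g in
        Cr_on None (chart_codom phi `&` iota @^-1` chart_dom psi)
                   (psi \o iota))].

Section MappingGroups.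
Context {R : realType} {F : tvsType R} {G : topGroupType} {M : topologicalType}.
Implicit Types (A : rough_chart R M -> Prop) (B : chart G F -> Prop).
Implicit Types (g : M -> G) (K L : set M) (r : option nat).

Definition gsupport g : set M := closure [set x | g x <> 1%g].

(* For r = 0, the atlases play no role. *)
Definition Cr_map r A B g : Prop :=
  continuous g /\
  (r <> Some 0%N ->
     forall (phi : rough_chart R M) (psi : chart G F), A phi -> B psi ->
     Cr_on r (phi @` (chart_dom phi `&` g @^-1` chart_dom psi))
             (psi \o g \o chart_inv phi)).

Definition CrL r A B L : set (M -> G) :=
  [set g | Cr_map r A B g /\ gsupport g `<=` L].

Definition Crc r A B : set (M -> G) :=
  [set g | Cr_map r A B g /\ compact (gsupport g)].

Definition CL L : set (M -> G) := [set g | continuous g /\ gsupport g `<=` L].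

Definition C0 : set (M -> G) :=
  [set g | continuous g /\
     forall U, nbhs (1%g : G) U ->
       exists2 K, compact K & forall x, ~ K x -> U (g x)].

End MappingGroups.

(* The topology of uniform convergence on functions M -> F, with respect to
   the translation-invariant uniformity of F (the uniformity which a
   [tvsType] carries need not be that one). *)
Definition unif_open (R : realType) (F : tvsType R) (M : Type)
    (W : set (M -> F)) : Prop :=
  forall v, W v -> exists2 Q, nbhs (0 : F) Q &
    forall w, (forall x, Q (w x - v x)) -> W w.

(* [mapspace B X], to be used with X = C0 or X = CL L, is the group X of maps
   M -> G with its Lie group topology. For phi in B a chart of G around 1 with
   phi 1 = 0, domain U and codomain V, the charts of X are the map
   h |-> phi \o h from the U-valued functions in X to the V-valued functions
   in C_0(M,F), respectively C_L(M,F), and its left translates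
   h |-> phi \o (g^-1 h) for g in X. As in any manifold, a set is open iff its
   images under all these charts are (relatively) open, for the topology of
   uniform convergence. *)
Definition mapspace (R : realType) (F : tvsType R) (G : topGroupType)
    (M : topologicalType) (B : chart G F -> Prop) (X : set (M -> G)) : Type :=
  {g : M -> G | X g}.

Section MapspaceTopology.
Context {R : realType} {F : tvsType R} {G : topGroupType} {M : topologicalType}.
Variables (B : chart G F -> Prop) (X : set (M -> G)).
Local Notation T := (mapspace B X).

Definition mapspace_open (O : set T) : Prop :=
  forall (g : T) (phi : chart G F),
    B phi -> chart_dom phi 1%g -> phi 1%g = 0 ->
  exists2 W : set (M -> F), unif_open W &
    forall h : T, let k := fun x => ((sval g x)^-1 * sval h x)%g in
      (forall x, chart_dom phi (k x)) -> (O h <-> W (phi \o k)).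

Lemma mapspace_openT : mapspace_open setT.
Proof.
by move=> g phi _ _ _; exists setT => // v _; exists setT => //; exact: filterT.
Qed.

Lemma mapspace_openI : setI_closed mapspace_open.
Proof.
move=> O1 O2 o1 o2 g phi Bphi d1 p1.
have [W1 oW1 W1P] := o1 g phi Bphi d1 p1.
have [W2 oW2 W2P] := o2 g phi Bphi d1 p1.
exists (W1 `&` W2) => [v [/oW1[Q1 Q10 Q1P] /oW2[Q2 Q20 Q2P]]|h k kU].
  exists (Q1 `&` Q2); first exact: filterI.
  by move=> w wQ; split; [apply: Q1P|apply: Q2P] => x; case: (wQ x).
have [h11 h12] := W1P h kU; have [h21 h22] := W2P h kU.
by split=> -[? ?]; split; auto.
Qed.

Lemma mapspace_open_bigU (I : Type) (f : I -> set T) :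
  (forall i, mapspace_open (f i)) -> mapspace_open (\bigcup_i f i).
Proof.
move=> of_ g phi Bphi d1 p1.
have /choice[W WP] : forall i, exists W : set (M -> F), unif_open W /\
    forall h : T, let k := fun x => ((sval g x)^-1 * sval h x)%g in
      (forall x, chart_dom phi (k x)) -> (f i h <-> W (phi \o k)).
  by move=> i; have [W ? ?] := of_ i g phi Bphi d1 p1; exists W.
exists (\bigcup_i W i) => [v [i _ /(WP i).1[Q Q0 QP]]|h k kU].
  by exists Q => // w /QP Ww; exists i.
by split=> -[i _ fh]; exists i => //; apply/((WP i).2 h kU).
Qed.

HB.instance Definition _ := gen_eqMixin T.
HB.instance Definition _ := gen_choiceMixin T.
HB.instance Definition _ := isOpenTopological.Build T
  mapspace_openT mapspace_openI mapspace_open_bigU.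

End MapspaceTopology.

(* The closure of S `&` X in the space X, as a set of maps M -> G. *)
Definition closure_in (R : realType) (F : tvsType R) (G : topGroupType)
    (M : topologicalType) (B : chart G F -> Prop) (X S : set (M -> G)) :
    set (M -> G) :=
  [set sval h | h in closure [set h : mapspace B X | S (sval h)]].

(* Main.v *)
(* To approximate a continuous h by a C^r-map, h is improved finitely often.
   Near a point, in a chart psi of G, the current map k is replaced by
   psi^-1 (psi k + theta (c - psi k)) with a C^r cutoff function theta and a
   constant c close to psi h. By convexity this moves k no further away from h;
   it keeps k of class C^r wherever k was so, and makes it constant where theta
   is 1. That every map close to h can be improved on D is stable under finite
   unions of sets D, so compactness gives C^r-maps uniformly close to h. Cutoff
   functions exist because on a locally compact chart domain finitely many
   continuous linear functionals (Hahn-Banach), composed with a smooth step,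
   separate a point from the boundary of a compact neighbourhood. For maps
   vanishing at infinity, a self-map of G close to the identity that sends a
   neighbourhood of 1 to 1 first makes the support compact. *)

Require Import Defs.
From HB Require Import structures.
From mathcomp Require Import all_boot all_order all_algebra.
From mathcomp Require Import all_classical all_reals all_analysis.
From mathcomp Require Import ring lra.
Import Order.TTheory GRing.Theory Num.Theory.
Import numFieldNormedType.Exports.
Local Open Scope classical_set_scope.
Local Open Scope ring_scope.

Set Implicit Arguments.
Unset Strict Implicit.
Unset Printing Implicit Defensive.

(** * Topology and convexity *)

(** Closeness of maps into [G] is measured throughout by [h x ^-1 * k x] lying in a neighbourhood of
    1 for all [x]; the topology of [mapspace], given by charts, is compared with this notion only at
    the end. Convexity makes sense only inside one chart of [G]. There a step loses nothing: being
    [Q]-close to [h] is preserved exactly, so the number of steps does not matter. Between different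
    charts only products of neighbourhoods control the error, and these must be shrunk at each
    union. Hence two nested compactness arguments. On the side of [M] the obstacle is that charts
    have values in merely regular subsets of spaces that may be infinite-dimensional: at
    non-interior points derivatives are just limits, so the chain rule needs maps that send interior
    to interior, and smooth functions on the model space with small support need not exist. A cutoff
    is therefore only made to vanish near the compact boundary of a neighbourhood, and is extended
    by 0 on [M] itself. *)

Section Topology.
Implicit Types X Y Z : topologicalType.

Lemma compact_ind X (P : set X -> Prop) (K : set X) :
  P set0 -> (forall A B, A `<=` B -> P B -> P A) ->
  (forall A B, P A -> P B -> P (A `|` B)) ->
  compact K -> (forall x, K x -> exists2 N, nbhs x N & P N) -> P K.
Proof.
move=> P0 Pmono PU cK Ploc; apply: contrapT => nPK.
(* If [P K] fails, the sets whose complement in [K] satisfies [P] form a proper filter containing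
   [K]. For a neighbourhood [N] of a cluster point with [P N], the complement of [N] is in the
   filter and would have to meet [N]. *)
pose F : set_system X := [set B | P (K `\` B)].
have FF : ProperFilter F.
  split; first by rewrite /F /= setD0.
  split; first by rewrite /F /= setDT.
    by move=> A B; rewrite /F /= setDIr; exact: PU.
  by move=> A B AB; apply: Pmono; exact: setDS.
have [|x [Kx clx]] := cK F FF; first by rewrite /F /= setDv.
have [N Nx PN] := Ploc x Kx.
have [|y [nNy Ny]] := clx (~` N) N _ Nx; last exact: nNy.
by apply: Pmono PN => y [_]; rewrite /= notK.
Qed.

Definition cont_on X Y (D : set X) (f : X -> Y) :=
  forall x, D x -> f @ within D (nbhs x) --> f x.

Lemma cont_onP X Y (D : set X) (f : X -> Y) :
  {within D, continuous f} <-> cont_on D f.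
Proof. exact: subspace_continuousP. Qed.

Lemma continuous_cont_on X Y (D : set X) (f : X -> Y) :
  continuous f -> cont_on D f.
Proof. by move=> cf x _; apply: cvg_within_filter; exact: cf. Qed.

Lemma cont_onT X Y (f : X -> Y) : cont_on setT f -> continuous f.
Proof.
move=> cf x; have := cf x I.
by rewrite within_interior// interiorT.
Qed.

Lemma cont_on_open X Y (D : set X) (f : X -> Y) x :
  open D -> D x -> cont_on D f -> {for x, continuous f}.
Proof.
move=> oD Dx /(_ x Dx); rewrite within_interior//.
by move/interior_id: oD => ->.
Qed.

Lemma cont_onS X Y (D D' : set X) (f : X -> Y) :
  D' `<=` D -> cont_on D f -> cont_on D' f.
Proof.
move=> DD cf x Dx; apply: cvg_trans (cf x (DD _ Dx)).
by apply: cvg_app; exact: within_subset.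
Qed.

Lemma cont_on_ext X Y (D : set X) (f g : X -> Y) :
  {in D, f =1 g} -> cont_on D f -> cont_on D g.
Proof.
move=> fg cf x Dx; rewrite -fg ?inE//; apply: cvg_trans (cf x Dx).
apply: near_eq_cvg; rewrite near_withinE; near=> y => Dy.
by apply: fg; rewrite inE.
Unshelve. all: by end_near. Qed.

Lemma cont_on_comp X Y Z (D : set X) (D' : set Y) (f : X -> Y) (g : Y -> Z) :
  (forall x, D x -> D' (f x)) -> cont_on D f -> cont_on D' g ->
  cont_on D (g \o f).
Proof.
move=> DD cf cg x Dx U /(cg _ (DD _ Dx)) gU; have h := cf x Dx _ gU.
change (nbhs x [set y | D y -> D' (f y) -> U (g (f y))]) in h.
change (nbhs x [set y | D y -> U (g (f y))]).
by apply: filterS h => y h Dy; exact: h Dy (DD _ Dy).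
Qed.

Lemma cont_on_pair X Y Z (D : set X) (f : X -> Y) (g : X -> Z) :
  cont_on D f -> cont_on D g -> cont_on D (fun x => (f x, g x)).
Proof. by move=> cf cg x Dx; apply: cvg_pair; [exact: cf|exact: cg]. Qed.

Lemma cont_on_local X Y (D : set X) (f : X -> Y) :
  (forall x, D x -> exists O, [/\ open O, O x & cont_on (D `&` O) f]) ->
  cont_on D f.
Proof.
move=> loc x Dx; have [V [oV Vx cf]] := loc x Dx.
move=> U Ufx; have h := cf x (conj Dx Vx) _ Ufx.
change (nbhs x [set y | (D `&` V) y -> U (f y)]) in h.
change (nbhs x [set y | D y -> U (f y)]);
  have nV := open_nbhs_nbhs (conj oV Vx).
near=> y => Dy; have Vy : V y by near: y.
have DVy : D y /\ V y -> U (f y) by near: y; exact: h.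
exact: DVy.
Unshelve. all: by end_near. Qed.

Lemma interior_setXT X Y (A : set X) (p : X * Y) :
  (A `*` [set: Y])° p <-> A° p.1.
Proof.
split=> [[[U V] /= [Up Vp] UV]|Ap].
  apply: filterS Up => x Ux.
  by have [] := UV (x, p.2) (conj Ux (nbhs_singleton Vp)).
by exists (A, setT) => //=; split=> //; exact: filterT.
Qed.

Lemma open_setX X Y (A : set X) (B : set Y) :
  open A -> open B -> open (A `*` B).
Proof.
move=> oA oB; rewrite openE => -[x y] [/= Ax By].
by exists (A, B) => //; split; apply: open_nbhs_nbhs.
Qed.

Lemma fst_continuous X Y : continuous (@fst X Y).
Proof. by move=> p; exact: cvg_fst. Qed.

Lemma snd_continuous X Y : continuous (@snd X Y).
Proof. by move=> p; exact: cvg_snd. Qed.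

Lemma pair_continuous X Y Z (f : X -> Y) (g : X -> Z) :
  continuous f -> continuous g -> continuous (fun x => (f x, g x)).
Proof.
move=> cf cg; apply: cont_onT.
by apply: cont_on_pair; exact: continuous_cont_on.
Qed.

Lemma comp_continuous X Y Z (f : X -> Y) (g : Y -> Z) :
  continuous f -> continuous g -> continuous (g \o f).
Proof. by move=> cf cg x; apply: continuous_comp; [exact: cf|exact: cg]. Qed.

End Topology.

Section Tvs.
Context {R : realType}.
Implicit Types E F : tvsType R.

Definition cvx F (Q : set F) := forall a b (t : R),
  Q a -> Q b -> 0 <= t -> t <= 1 -> Q (t *: a + (1 - t) *: b).

Lemma cvx_nbhs F (x : F) (U : set F) : nbhs x U ->
  exists Q, [/\ open Q, Q x, Q `<=` U & cvx Q].
Proof.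
move=> Ux; have [B Bc [Bo Bb]] := @locally_convex R F.
have [Q [BQ Qx] QU] := Bb x U Ux; exists Q; split => //; first exact: Bo.
move=> a b t Qa Qb t0 t1.
have := Bc Q (mem_set BQ) a b (Itv01 t0 t1) (mem_set Qa) (mem_set Qb).
by rewrite inE.
Qed.

Lemma tvs_cvgD F (T : Type) (H : set_system T) {FH : Filter H}
    (f g : T -> F) (a b : F) :
  f @ H --> a -> g @ H --> b -> (fun i => f i + g i) @ H --> a + b.
Proof.
by move=> fa gb; apply: (cvg_comp2 fa gb); exact: (@add_continuous F (a, b)).
Qed.

Lemma tvs_cvgZ F (T : Type) (H : set_system T) {FH : Filter H}
    (f : T -> R) (g : T -> F) (a : R) (b : F) :
  f @ H --> a -> g @ H --> b -> (fun i => f i *: g i) @ H --> a *: b.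
Proof.
by move=> fa gb; apply: (cvg_comp2 fa gb);
   exact: (@scale_continuous R F (a, b)).
Qed.

Lemma tvs_cvgN F (T : Type) (H : set_system T) {FH : Filter H}
    (f : T -> F) (a : F) : f @ H --> a -> (fun i => - f i) @ H --> - a.
Proof. by move=> fa; exact: (cvg_comp f -%R fa (@opp_continuous F a)). Qed.

Lemma tvs_cvgB F (T : Type) (H : set_system T) {FH : Filter H}
    (f g : T -> F) (a b : F) :
  f @ H --> a -> g @ H --> b -> (fun i => f i - g i) @ H --> a - b.
Proof. by move=> fa gb; apply: tvs_cvgD => //; exact: tvs_cvgN. Qed.

Lemma cvg_line E (x y : E) : (fun t : R => x + t *: y) @ (0 : R)^' --> x.
Proof.
have {2}-> : x = x + 0 *: y by rewrite scale0r addr0.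
apply: tvs_cvgD; first exact: cvg_cst.
by apply: tvs_cvgZ; [exact: nbhs_dnbhs|exact: cvg_cst].
Qed.

Lemma dderiv_uniq E F (f : E -> F) y x l l' :
  hausdorff_space F -> is_dderiv f y x l -> is_dderiv f y x l' -> l = l'.
Proof. by move=> hF; apply: cvg_unique. Qed.

Lemma is_dderivE E F (f : E -> F) y x l :
  hausdorff_space F -> is_dderiv f y x l -> dderiv f y x = l.
Proof.
move=> hF fl; apply: (@dderiv_uniq E F f y x) => //.
exact: (@xgetPex _ _ [set l | is_dderiv f y x l] (ex_intro _ l fl)).
Qed.

Lemma is_dderiv_near E F (f g : E -> F) y x l :
  (\forall z \near x, f z = g z) -> is_dderiv f y x l -> is_dderiv g y x l.
Proof.
move=> fg; apply: cvg_trans; apply: near_eq_cvg.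
have gx : f x = g x by exact: nbhs_singleton fg.
near=> t; rewrite /diff_quot gx; congr (_ *: (_ - _)).
by near: t; exact: (@cvg_line _ x y _ fg).
Unshelve. all: by end_near. Qed.

(** A mean value theorem without integrals: the slope over [[a, d]] is a convex combination of those
    over [[a, b]] and [[b, d]], and slopes over short intervals ending at [s] lie in the open set
    [Q] because [g s] does. A supremum argument leads from 0 to 1. *)
Lemma mvt_cvx F (Q : set F) (c g : R -> F) : open Q -> cvx Q ->
  (forall s, 0 <= s <= 1 ->
    (fun h : R => h^-1 *: (c (s + h) - c s)) @ (0 : R)^' --> g s) ->
  (forall s, 0 <= s <= 1 -> Q (g s)) -> Q (c 1 - c 0).
Proof.
move=> oQ cQ dc Qg.
pose P a b := Q ((b - a)^-1 *: (c b - c a)).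
have Ptrans a b d : a < b -> b < d -> P a b -> P b d -> P a d.
  move=> ab bd Pab Pbd; pose t := (b - a) / (d - a).
  have da0 : 0 < d - a by rewrite subr_gt0 (lt_trans ab).
  have ba0 : 0 < b - a by rewrite subr_gt0.
  have db0 : 0 < d - b by rewrite subr_gt0.
  have t0 : 0 <= t by rewrite /t divr_ge0 ?ltW.
  have t1 : t <= 1 by rewrite /t ler_pdivrMr //; lra.
  have := cQ _ _ t Pab Pbd t0 t1; rewrite /t.
  have -> : 1 - (b - a) / (d - a) = (d - b) / (d - a) by field; rewrite gt_eqF.
  have E1 : (b - a) / (d - a) * (b - a)^-1 = (d - a)^-1.
    by field; rewrite !gt_eqF.
  have E2 : (d - b) / (d - a) * (d - b)^-1 = (d - a)^-1.
    by field; rewrite !gt_eqF.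
  rewrite /P !scalerA E1 E2 -scalerDr.
  by congr (Q (_ *: _)); rewrite addrC addrA subrK.
have Ploc s : 0 <= s <= 1 -> exists2 e : R, 0 < e &
    (forall b, s < b -> b < s + e -> P s b) /\
    (forall a, a < s -> s - e < a -> P a s).
  move=> s01; have Qn : nbhs (g s) Q by apply: open_nbhs_nbhs; split; auto.
  have /= := dc s s01 Q Qn; rewrite /dnbhs /within /= => -[e /= e0 eP].
  have {}eP h : h != 0 -> `|h| < e -> Q (h^-1 *: (c (s + h) - c s)).
    by move=> h0 he; apply: eP => //=; rewrite sub0r normrN.
  exists e => //; split=> [b sb be|a as_ ea].
    have := eP (b - s); rewrite (addrC s) subrK; apply; first by lra.
    by rewrite gtr0_norm; lra.
  have := eP (a - s); rewrite (addrC s) subrK => H.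
  rewrite /P -[X in Q X]opprK -scalerN opprB -scaleNr -invrN opprB.
  by apply: H; [lra|rewrite ltr0_norm; lra].
(* [b = 0] is left out: as the inverse of 0 is 0, [P 0 0] would say [Q 0]. *)
pose S := [set b : R | 0 < b <= 1 /\ P 0 b].
have S0 : S !=set0.
  have [//|e e0 [eP _]] := Ploc 0; first by rewrite lexx ler01.
  exists (Num.min (e / 2) 1); split.
    by rewrite lt_min ltr01 divr_gt0 //= ge_min lexx orbT.
  apply: eP; first by rewrite lt_min ltr01 divr_gt0.
  by rewrite add0r gt_min; apply/orP; left; lra.
have ubS : ubound S 1 by move=> b [/andP[]].
have supS : has_sup S by split => //; exists 1.
set d := sup S.
have d1 : d <= 1 by apply: sup_le_ub.
have d0 : 0 < d.
  have [b Sb] := S0; apply: (@lt_le_trans _ _ b); first by case: Sb => /andP[].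
  by apply: ub_le_sup => //; exists 1.
have [|e e0 [er el]] := Ploc d; first by rewrite d1 ltW.
have P0d : P 0 d.
  have [b Sb eb] := sup_adherent e0 supS.
  have : b <= d by apply: ub_le_sup => //; exists 1.
  case: Sb => /andP[b0 b1] Pb.
  rewrite le_eqVlt => /orP[/eqP<- //|bd].
  by apply: (Ptrans _ _ _ b0 bd Pb); apply: el.
move: d1; rewrite le_eqVlt => /orP[/eqP d1|d1].
  by move: P0d; rewrite d1 /P subr0 invr1 scale1r.
pose b := Num.min (d + e / 2) 1.
have db : d < b by rewrite lt_min d1 andbT; lra.
have : S b.
  split; first by rewrite (lt_trans d0 db) /= ge_min lexx orbT.
  apply: (Ptrans _ _ _ d0 db P0d); apply: er => //.
  by rewrite gt_min; apply/orP; left; lra.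
move=> Sb; have : b <= d by apply: ub_le_sup => //; exists 1.
by rewrite leNgt db.
Qed.

Lemma is_dderivZ E F (f : E -> F) y x l (a : R) :
  is_dderiv f y x l -> is_dderiv f (a *: y) x (a *: l).
Proof.
(* For [a = 0] the substitution of [t * a] for [t] would leave the punctured neighbourhood of 0. *)
have [->|a0] := eqVneq a 0 => fl.
  have h : (fun=> 0 *: l) @ (0 : R)^' --> 0 *: l by exact: cvg_cst.
  apply: cvg_trans h; apply: near_eq_cvg; near=> t.
  by rewrite /diff_quot !scale0r scaler0 addr0 subrr scaler0.
have cvga : (fun t : R => t * a) @ (0 : R)^' --> (0 : R)^'.
  move=> U; rewrite /dnbhs /within /= => -[e /= e0 eU].
  exists (e / `|a|); first by rewrite /= divr_gt0 ?normr_gt0.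
  move=> t /=; rewrite sub0r normrN ltr_pdivlMr ?normr_gt0 // => te t0.
  by apply: eU; [rewrite /= sub0r normrN normrM|rewrite mulf_neq0].
have : (fun t : R => a *: diff_quot f y x (t * a)) @ (0 : R)^' --> a *: l.
  apply: tvs_cvgZ; first exact: cvg_cst.
  by apply: cvg_comp cvga fl.
apply: cvg_trans; apply: near_eq_cvg; near=> t.
by rewrite /diff_quot !scalerA invfM mulrCA mulfV // mulr1.
Unshelve. all: by end_near. Qed.

(** Base point, direction and step vary together. Along the segment from [p i] to [p i + t i *: w i]
    the derivative in direction [w i] stays in a convex neighbourhood of [df (x, z)], hence so does
    the quotient, by [mvt_cvx]. Both additivity of derivatives and the chain rule rest on this. *)
Lemma diff_quot_cvg E F (f : E -> F) (df : E * E -> F) (V : set E) (x z : E)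
    (T : Type) (H : set_system T) {FH : Filter H} (p w : T -> E) (t : T -> R) :
  open V -> V x -> (forall q v, V q -> is_dderiv f v q (df (q, v))) ->
  {for (x, z), continuous df} ->
  p @ H --> x -> w @ H --> z -> t @ H --> (0 : R)^' ->
  (fun i => (t i)^-1 *: (f (p i + t i *: w i) - f (p i))) @ H --> df (x, z).
Proof.
move=> oV Vx fd cdf px wz t0 U /cvx_nbhs [Q [oQ Qx QU cQ]].
have cm : (fun q : E * (R^o * E) => (q.1 + q.2.1 *: q.2.2, q.2.2)) @
    nbhs (x, (0 : R^o, z)) --> (x, z).
  apply: cvg_pair; last first.
    by apply: cvg_comp; [exact: cvg_snd|exact: cvg_snd].
  have {2}-> : x = x + 0 *: z by rewrite scale0r addr0.
  apply: tvs_cvgD; first exact: cvg_fst.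
  apply: tvs_cvgZ; first by apply: cvg_comp; [exact: cvg_snd|exact: cvg_fst].
  by apply: cvg_comp; [exact: cvg_snd|exact: cvg_snd].
have nW : nbhs (x, z) [set q | V q.1 /\ Q (df q)].
  apply: filterI.
    by exists (V, setT) => /=; [split; [exact: open_nbhs_nbhs|exact: filterT]|
      move=> q []].
  by apply: cdf; exact: open_nbhs_nbhs.
have [[A1 A2] /= [A1x [[B C] /= [Bz Cz] BC]] AW] := cm _ nW.
have [e /= e0 eB] : nbhs (0 : R) B by [].
change (\forall i \near H, U ((t i)^-1 *: (f (p i + t i *: w i) - f (p i)))).
near=> i; apply: QU.
have ti0 : t i != 0 by near: i; exact: (t0 _ (nbhs_dnbhs_neq (0 : R))).
have te : `|t i| < e.
  near: i; apply: (t0 [set a : R | `|a| < e]).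
  rewrite nbhs_filterE; apply: nbhs_dnbhs.
  by exists e => //= a /=; rewrite sub0r normrN.
have Api : A1 (p i) by near: i; exact: px.
have Cwi : C (w i) by near: i; exact: wz.
have key (s : R) : 0 <= s <= 1 -> V (p i + (s * t i) *: w i) /\
    Q (df (p i + (s * t i) *: w i, w i)).
  move=> /andP[s0 s1]; apply: (AW (p i, (s * t i, w i))); split => //=.
  apply: BC; split => //=; apply: eB => /=; rewrite sub0r normrN normrM.
  by rewrite (le_lt_trans _ te) // ger0_norm // ler_piMl.
pose c s := (t i)^-1 *: f (p i + (s * t i) *: w i).
have := @mvt_cvx F Q c (fun s => df (p i + (s * t i) *: w i, w i)) oQ cQ.
rewrite /c mul0r mul1r scale0r addr0 -scalerBr; apply; last by move=> s /key[].
move=> s /key[Vs _]; have := @is_dderivZ _ _ _ _ _ _ (t i) (fd _ (w i) Vs).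
move=> h; have : (fun t0 => (t i)^-1 *: diff_quot f (t i *: w i)
   (p i + (s * t i) *: w i) t0) @ 0^' --> (t i)^-1 *: (t i *: df (p i + (s * t
     i) *: w i, w i)).
  by apply: tvs_cvgZ; [exact: cvg_cst|exact: h].
rewrite scalerA mulVf // scale1r; apply: cvg_trans; apply: near_eq_cvg.
near=> u; rewrite /diff_quot -scalerBr !scalerA mulrC; congr (_ *: (f _ - _)).
by rewrite -addrA -scalerDl mulrDl.
Unshelve. all: by end_near. Qed.

End Tvs.

(** * Bastiani calculus *)

Section Ck.
Context {R : realType}.

(** The quotient for [y + w] is the sum of that for [y] at [x] and that for [w] at the moving point
    [x + t *: y]; the latter converges by [diff_quot_cvg]. *)
Lemma dderiv_add (E F : tvsType R) (f : E -> F) (df : E * E -> F) V x y w :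
  hausdorff_space F ->
  open V -> V x -> (forall q v, V q -> is_dderiv f v q (df (q, v))) ->
  (forall q, V q.1 -> {for q, continuous df}) ->
  df (x, y + w) = df (x, y) + df (x, w).
Proof.
move=> hF oV Vx fd cdf; apply: (@dderiv_uniq _ _ _ f (y + w) x) => //.
  exact: fd.
have := @diff_quot_cvg _ _ _ f df V x w _ _ _ (fun t => x + t *: y)
  (fun=> w) id oV Vx fd (cdf (x, w) Vx) (@cvg_line _ _ x y) (cvg_cst _) cvg_id.
move=> h; have := tvs_cvgD (fd x y Vx) (h _ _).
move=> h2; apply: cvg_trans (h2 _ _ _); apply: near_eq_cvg; near=> t.
rewrite /diff_quot -scalerDr [t *: (y + w)]scalerDr (addrA x); congr (_ *: _).
by rewrite (addrC (f (x + t *: y) - _)) addrA subrK.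
Unshelve. all: by end_near. Qed.

(* Unlike [Cr_on], this recursion on the order makes the chain rule a plain
   induction; [Cr_onP] relates the two. *)
Fixpoint Ck (k : nat) (E F : tvsType R) (D : set E) (f : E -> F) : Prop :=
  cont_on D f /\
  if k is k'.+1 then
    exists df : E * E -> F,
      (forall x y, D° x -> is_dderiv f y x (df (x, y))) /\
      @Ck k' (E * E)%type F (D `*` setT) df
  else True.

Lemma Ck_cont k (E F : tvsType R) (D : set E) (f : E -> F) :
  Ck k D f -> cont_on D f.
Proof. by case: k => [|k] []. Qed.

Lemma CkW k j (E F : tvsType R) (D : set E) (f : E -> F) :
  (j <= k)%N -> Ck k D f -> Ck j D f.
Proof.
elim: j k E D f => [|j IH] [|k] E D f //= jk [cf]; first by [].
by move=> [df [fd dk]]; split => //; exists df; split => //; exact: (IH k).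
Qed.

Lemma CkS k (E F : tvsType R) (D D' : set E) (f : E -> F) :
  D' `<=` D -> Ck k D f -> Ck k D' f.
Proof.
elim: k E D D' f => [|k IH] E D D' f DD /= [cf Df].
  by split => //; exact: cont_onS cf.
split; first exact: cont_onS cf.
have [df [fd dk]] := Df; exists df; split.
  by move=> x y Dx; apply: fd; exact: interiorS Dx.
by apply: IH dk => -[x y] [/= Dx _]; split => //; exact: DD.
Qed.

Lemma Ck_ext k (E F : tvsType R) (D : set E) (f g : E -> F) :
  {in D, f =1 g} -> Ck k D f -> Ck k D g.
Proof.
move=> fg; case: k => [|k] [cf Df]; (split; first exact: cont_on_ext cf) => //.
have [df [fd dk]] := Df; exists df; split => // x y Dx.
apply: is_dderiv_near (fd x y Dx).
by apply: filterS Dx => z Dz; apply: fg; rewrite inE.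
Qed.

Lemma Ck_linear k (E F : tvsType R) (f : E -> F) (D : set E) :
  (forall t x y, f (x + t *: y) = f x + t *: f y) -> continuous f -> Ck k D f.
Proof.
move=> lf cf; apply: (@CkS k _ _ setT) => //.
elim: k E f lf cf {D} => [|k IH] E f lf cf; split => //;
  try exact: continuous_cont_on.
exists (f \o snd); split => [x y _ /=|].
  have h : (fun=> f y) @ (0 : R)^' --> f y by exact: cvg_cst.
  apply: cvg_trans h; apply: near_eq_cvg; near=> t.
  rewrite /diff_quot lf (addrC (f x)) addrK scalerA mulVf ?scale1r //.
  by near: t; exact: nbhs_dnbhs_neq.
rewrite setXTT; apply: IH => [t [x1 x2] [y1 y2] /=|]; first exact: lf.
by move=> x; apply: continuous_comp; [exact: cvg_snd|exact: cf].
Unshelve. all: by end_near. Qed.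

Lemma Ck_cst k (E F : tvsType R) (c : F) (D : set E) : Ck k D (fun=> c).
Proof.
elim: k E c D => [|k IH] E c D; split => //; try by move=> x _; exact: cvg_cst.
exists (fun=> 0); split => // x y _.
have h : (fun=> 0 : F) @ (0 : R)^' --> (0 : F) by exact: cvg_cst.
apply: cvg_trans h; apply: near_eq_cvg; near=> t.
by rewrite /diff_quot subrr scaler0.
Unshelve. all: by end_near. Qed.

Lemma Ck_pair k (E F1 F2 : tvsType R) (D : set E) (f : E -> F1) (g : E -> F2) :
  Ck k D f -> Ck k D g -> Ck k D (fun x => (f x, g x)).
Proof.
elim: k E D f g => [|k IH] E D f g [cf Df] [cg Dg];
  (split; first exact: cont_on_pair) => //.
have [[df [fd dk]] [dg [gd ek]]] := (Df, Dg).
exists (fun p => (df p, dg p)); split; last exact: IH.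
by move=> x y Dx; apply: cvg_pair; [exact: fd|exact: gd].
Qed.

Lemma Ck_fst k (E F : tvsType R) (D : set (E * F)) : Ck k D fst.
Proof. by apply: Ck_linear => // x; exact: cvg_fst. Qed.

Lemma Ck_snd k (E F : tvsType R) (D : set (E * F)) : Ck k D snd.
Proof. by apply: Ck_linear => // x; exact: cvg_snd. Qed.

(** The derivative [dg (f x, df (x, y))] is again a composition, to which the induction hypothesis
    applies. Interior points must go to interior points because [dg] is a derivative of [g] only
    over the interior of [D']. *)
Lemma Ck_comp k (E1 E2 F : tvsType R) (D : set E1) (D' : set E2)
    (f : E1 -> E2) (g : E2 -> F) :
  (forall x, D x -> D' (f x)) -> (forall x, D° x -> D'° (f x)) ->
  Ck k D f -> Ck k D' g -> Ck k D (g \o f).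
Proof.
elim: k E1 E2 F D D' f g => [|k IH] E1 E2 F D D' f g DD DDi fk gk;
  have [[cf Df] [cg Dg]] := (fk, gk);
  (split; first exact: cont_on_comp cf cg) => //.
have [[df [fd dk]] [dg [gd ek]]] := (Df, Dg).
exists (fun p => dg (f p.1, df p)); split => [x y Dx|].
  (* [f (x + t *: y)] is [f x] plus [t] times the direction [diff_quot f y x t], which itself
     converges. *)
  have h : (fun t : R => t^-1 *: (g (f x + t *: diff_quot f y x t) - g (f x)))
      @ (0 : R)^' --> dg (f x, df (x, y)).
    apply: (@diff_quot_cvg _ _ _ g dg D'°) => //.
    - exact: open_interior.
    - exact: DDi.
    - apply: (@cont_on_open _ _ (D'° `*` setT)).
      + exact: open_setX (open_interior _) openT.
      + by split => //; exact: DDi.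
      + apply: cont_onS (Ck_cont ek) => -[q v] [/= Dq _]; split => //.
        exact: interior_subset.
    - exact: cvg_cst.
    - exact: fd.
  apply: cvg_trans h; apply: near_eq_cvg; near=> t.
  rewrite /diff_quot scalerA mulfV; last by near: t; exact: nbhs_dnbhs_neq.
  by rewrite scale1r (addrC (f x)) subrK.
apply: (IH _ _ _ _ (D' `*` setT)) ek.
- by move=> [x y] [/= Dx _]; split => //; exact: DD.
- by move=> p /interior_setXT Dp; apply/interior_setXT; exact: DDi.
apply: Ck_pair dk; apply: (IH _ _ _ _ D fst f) => //.
- by move=> p [].
- by move=> p /interior_setXT.
- exact: Ck_fst.
- exact: CkW fk.
Unshelve. all: by end_near. Qed.

Lemma Ck_compT k (E1 E2 F : tvsType R) (D : set E1) (f : E1 -> E2)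
    (g : E2 -> F) : Ck k D f -> Ck k setT g -> Ck k D (g \o f).
Proof. by apply: Ck_comp => // x _; rewrite interiorT. Qed.

Lemma Ck_add k (E F : tvsType R) (D : set E) (f g : E -> F) :
  Ck k D f -> Ck k D g -> Ck k D (fun x => f x + g x).
Proof.
move=> fk gk; apply: (Ck_compT (Ck_pair fk gk) (g := fun p => p.1 + p.2)).
apply: Ck_linear; last exact: add_continuous.
by move=> t x y /=; rewrite scalerDr addrACA.
Qed.

(** The derivative of [a *: v] in direction [(b, w)] is [a *: w + b *: v]: twice the same map after
    a continuous linear map, whence the induction. *)
Lemma Ck_scale_fun k (F : tvsType R) :
  Ck k [set: R^o * F] (fun p => p.1 *: p.2).
Proof.
elim: k => [|k IH];
  (split; first by apply: continuous_cont_on; exact: scale_continuous) => //.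
exists (fun p => p.1.1 *: p.2.2 + p.2.1 *: p.1.2); split => [[a v] [b w] _|].
  have h : (fun t : R => a *: w + b *: (v + t *: w)) @ (0 : R)^' -->
      a *: w + b *: v.
    apply: tvs_cvgD; first exact: cvg_cst.
    by apply: tvs_cvgZ; [exact: cvg_cst|exact: cvg_line].
  apply: cvg_trans h; apply: near_eq_cvg; near=> t; rewrite /diff_quot /=.
  have t0 : t != 0 by near: t; exact: nbhs_dnbhs_neq.
  have -> : (a + t *: b) *: (v + t *: w) - a *: v =
      t *: (a *: w + b *: (v + t *: w)).
    rewrite scalerDl (scalerDr a) addrAC (addrC (a *: v)) addrK.
    by rewrite [RHS]scalerDr !scalerA (mulrC a).
  by rewrite scalerA mulVf // scale1r.
rewrite setXTT; apply: Ck_add.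
- apply: (Ck_compT (f := fun p : (R^o * F) * (R^o * F) => (p.1.1, p.2.2)) _ IH).
  apply: Ck_linear => //; apply: pair_continuous.
    exact: comp_continuous (@fst_continuous _ _) (@fst_continuous _ _).
  exact: comp_continuous (@snd_continuous _ _) (@snd_continuous _ _).
- apply: (Ck_compT (f := fun p : (R^o * F) * (R^o * F) => (p.2.1, p.1.2)) _ IH).
  apply: Ck_linear => //; apply: pair_continuous.
    exact: comp_continuous (@snd_continuous _ _) (@fst_continuous _ _).
  exact: comp_continuous (@fst_continuous _ _) (@snd_continuous _ _).
Unshelve. all: by end_near. Qed.

Lemma Ck_scale k (E F : tvsType R) (D : set E) (f : E -> R^o) (g : E -> F) :
  Ck k D f -> Ck k D g -> Ck k D (fun x => f x *: g x).
Proof.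
move=> fk gk.
exact: (@Ck_compT k E (R^o * F)%type F D _ _ (Ck_pair fk gk) (Ck_scale_fun k
  F)).
Qed.

Lemma regular_setXT (E E' : tvsType R) (D : set E) :
  regular_set D -> regular_set (D `*` [set: E']).
Proof.
move=> rD [x y] [/= Dx _] U [[A B] /= [Ax By] AB].
have [x' [Dx' Ax']] := rD x Dx A Ax.
exists (x', y); split; first exact/interior_setXT.
by apply: AB; split => //=; exact: nbhs_singleton.
Qed.

Lemma interiorI_open (X : topologicalType) (D V : set X) x :
  open V -> V x -> (D `&` V)° x <-> D° x.
Proof.
move=> oV Vx; split; first by apply: filterS => y [].
by move=> Dx; apply: filterI => //; exact: open_nbhs_nbhs.
Qed.

Lemma regular_setI_open (E : tvsType R) (D V : set E) :
  open V -> regular_set D -> regular_set (D `&` V).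
Proof.
move=> oV rD x [Dx Vx] U Ux.
have [|y [Dy [Uy Vy]]] := rD x Dx (U `&` V).
  by apply: filterI => //; exact: open_nbhs_nbhs.
by exists y; split => //; apply/interiorI_open.
Qed.

Lemma Ck_local k (E F : tvsType R) (D : set E) (f : E -> F) :
  hausdorff_space F -> regular_set D ->
  (forall x, D x -> exists V, [/\ open V, V x & Ck k (D `&` V) f]) ->
  Ck k D f.
Proof.
move=> hF; elim: k E D f => [|k IH] E D f rD loc.
  split => //; apply: cont_on_local => x /loc[V [oV Vx [cf _]]].
  by exists V.
split.
  by apply: cont_on_local => x /loc[V [oV Vx [cf _]]]; exists V.
(* The limit from the interior does not depend on the neighbourhood, so that
   the local extensions of the derivative fit together. *)
pose df (p : E * E) :=
    xget 0 [set l | dderiv f p.2 @ within D° (nbhs p.1) --> l].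
have dfE V df' : open V -> Ck k ((D `&` V) `*` setT) df' ->
    (forall x y, (D `&` V)° x -> is_dderiv f y x (df' (x, y))) ->
    {in ((D `&` V) `*` setT), df' =1 df}.
  move=> oV dk fd [x y]; rewrite inE /= => -[[/= Dx Vx] _].
  have PF : ProperFilter (within D° (nbhs x)).
    by apply: within_nbhs_proper; exact: rD.
  suff dfl : dderiv f y @ within D° (nbhs x) --> df' (x, y).
    have := @xgetPex _ 0 [set l | dderiv f y @ within D° (nbhs x) --> l]
      (ex_intro _ (df' (x, y)) dfl).
    move=> dfl'; apply: (cvg_unique _ dfl dfl'); exact: hF.
  have : (fun x' => df' (x', y)) @ within D° (nbhs x) --> df' (x, y).
    have h1 : cont_on (D `&` V) (fun x' => df' (x', y)).
      apply: (cont_on_comp (D' := (D `&` V) `*` setT)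
        (f := fun x' => (x', y)) (g := df')); last exact: Ck_cont dk.
      - by [].
      - by apply: cont_on_pair => z _; [exact: cvg_within|exact: cvg_cst].
    move=> U Uf; have h := h1 x (conj Dx Vx) U Uf.
    change (nbhs x [set z | (D `&` V) z -> U (df' (z, y))]) in h.
    change (nbhs x [set z | D° z -> U (df' (z, y))]).
    have nV : nbhs x V by apply: open_nbhs_nbhs.
    apply: filterS (filterI nV h) => z [Vz hz] Dz; apply: hz; split => //.
    exact: interior_subset.
  apply: cvg_trans; apply: near_eq_cvg; rewrite near_withinE.
  have nV : nbhs x V by apply: open_nbhs_nbhs.
  apply: filterS nV => z Vz Dz; apply: esym; apply: is_dderivE => //.
  by apply: fd; apply/interiorI_open.
exists df; split => [x y Dx|].
  have [V [oV Vx [_ [df' [fd dk]]]]] := loc x (interior_subset Dx).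
  rewrite -(dfE V df') //; last first.
    by rewrite inE; split => //; split => //; exact: interior_subset.
  by apply: fd; apply/interiorI_open.
apply: IH; first exact: regular_setXT.
move=> [x y] [/= Dx _].
have [V [oV Vx [_ [df' [fd dk]]]]] := loc x Dx.
exists (V `*` setT); split => //; first exact: open_setX oV openT.
have -> : D `*` setT `&` V `*` setT = (D `&` V) `*` [set: E].
  by apply/seteqP; split=> -[a b] /=; tauto.
exact: Ck_ext (dfE V df' oV dk fd) dk.
Qed.

End Ck.

(** * Iterated directional derivatives *)

Section Jets.
Context {R : realType}.

Lemma ptws_cont_on (T : topologicalType) (E : tvsType R) (I : eqType)
    (S : set T) (Y : I -> T -> E) : (forall i, cont_on S (Y i)) ->
  cont_on S (fun t => (fun i => Y i t) : {ptws I -> E}).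
Proof.
move=> cY t St; apply/cvg_sup => i U [B [[C oC <-] Bt] BU].
have h' : nbhs (Y i t) C by apply: open_nbhs_nbhs.
have {}h' := cY i t St C h'.
change (nbhs t [set s | S s -> U (fun i => Y i s)]).
change (nbhs t [set s | S s -> C (Y i s)]) in h'.
by apply: filterS h' => s h' Ss; apply: BU; exact: h'.
Qed.

Lemma ptws_proj_continuous (E : tvsType R) (I : eqType) (i : I) :
  continuous (fun y : {ptws I -> E} => y i).
Proof. exact: (@proj_continuous I (fun=> E) i). Qed.

(** Relational counterpart of [iter_dderiv]: intermediate derivatives are any functions with the
    right values on [V], so that sums and concatenations need no reasoning about chosen limits. *)
Fixpoint is_iter (E F : tvsType R) (V : set E) (f : E -> F) (ys : seq E)
    (h : E -> F) : Prop :=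
  if ys is y :: ys' then exists f1,
    (forall x, V x -> is_dderiv f y x (f1 x)) /\ is_iter V f1 ys' h
  else forall x, V x -> f x = h x.

Section Iter.
Context {E F : tvsType R}.
Hypothesis hF : hausdorff_space F.
Implicit Types (f h : E -> F) (V : set E).

Lemma is_dderiv_open V f g y x l : open V -> V x ->
  (forall z, V z -> f z = g z) -> is_dderiv f y x l -> is_dderiv g y x l.
Proof.
move=> oV Vx fg; apply: is_dderiv_near.
have nV : nbhs x V by apply: open_nbhs_nbhs.
exact: filterS nV.
Qed.

Lemma is_dderivD f g y x l m : is_dderiv f y x l -> is_dderiv g y x m ->
  is_dderiv (fun z => f z + g z) y x (l + m).
Proof.
move=> fl gm; have := tvs_cvgD fl gm => /(_ _); apply: cvg_trans.
apply: near_eq_cvg; near=> t.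
by rewrite /diff_quot -scalerDr opprD addrACA.
Unshelve. all: by end_near. Qed.

Lemma is_dderivZr f y x l (a : R) : is_dderiv f y x l ->
  is_dderiv (fun z => a *: f z) y x (a *: l).
Proof.
move=> fl.
have : (fun t => a *: diff_quot f y x t) @ (0 : R)^' --> a *: l.
  by apply: tvs_cvgZ fl; exact: cvg_cst.
apply: cvg_trans; apply: near_eq_cvg; near=> t.
by rewrite /diff_quot -scalerBr !scalerA mulrC.
Unshelve. all: by end_near. Qed.

Lemma is_iter_ext V f f' h h' ys : open V ->
  (forall x, V x -> f x = f' x) -> (forall x, V x -> h x = h' x) ->
  is_iter V f ys h -> is_iter V f' ys h'.
Proof.
move=> oV; elim: ys f f' => [|y ys IH] f f' ff hh /=.
  by move=> fh x Vx; rewrite -ff// fh// hh.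
move=> [f1 [fd i1]]; exists f1; split; last exact: IH i1.
by move=> x Vx; apply: (is_dderiv_open oV Vx ff); exact: fd.
Qed.

Lemma is_iter_uniq V f h h' ys : open V ->
  is_iter V f ys h -> is_iter V f ys h' -> forall x, V x -> h x = h' x.
Proof.
move=> oV; elim: ys f => [|y ys IH] f /=.
  by move=> fh fh' x Vx; rewrite -fh// fh'.
move=> [f1 [fd i1]] [f2 [fd2 i2]]; apply: (IH f1) => //.
apply: is_iter_ext i2 => // x Vx.
by apply: (@dderiv_uniq _ _ _ f y x) => //; [exact: fd2|exact: fd].
Qed.

Lemma is_iterD V f g h k ys : is_iter V f ys h -> is_iter V g ys k ->
  is_iter V (fun x => f x + g x) ys (fun x => h x + k x).
Proof.
elim: ys f g => [|y ys IH] f g /=; first by move=> fh gk x Vx; rewrite fh// gk.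
move=> [f1 [fd i1]] [g1 [gd i2]]; exists (fun x => f1 x + g1 x); split.
  by move=> x Vx; apply: is_dderivD; [exact: fd|exact: gd].
exact: IH.
Qed.

Lemma is_iterZ V f h ys (a : R) : is_iter V f ys h ->
  is_iter V (fun x => a *: f x) ys (fun x => a *: h x).
Proof.
elim: ys f => [|y ys IH] f /=; first by move=> fh x Vx; rewrite fh.
move=> [f1 [fd i1]]; exists (fun x => a *: f1 x); split; last exact: IH.
by move=> x Vx; apply: is_dderivZr; exact: fd.
Qed.

Lemma is_iter_cat V f h ys zs : open V -> is_iter V f (ys ++ zs) h <->
  exists2 k, is_iter V f ys k & is_iter V k zs h.
Proof.
move=> oV; elim: ys f => [|y ys IH] f /=.
  split=> [fh|[k fk kh]]; first by exists f.
  by apply: is_iter_ext kh => // x Vx; rewrite fk.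
split=> [[f1 [fd /IH[k f1k kh]]]|[k [f1 [fd f1k]] kh]].
  by exists k => //; exists f1.
by exists f1; split => //; apply/IH; exists k.
Qed.

Lemma is_iterP V f h ys x : open V -> is_iter V f ys h -> V x ->
  iter_dderivable f ys x /\ iter_dderiv f ys x = h x.
Proof.
move=> oV; elim: ys f => [|y ys IH] f /=; first by move=> fh Vx; rewrite fh.
move=> [f1 [fd i1]] Vx.
have [|H1 H2] := IH (dderiv f y) _ Vx.
  apply: is_iter_ext i1 => // z Vz.
  by apply: esym; apply: is_dderivE => //; exact: fd.
by split => //; split => //; exists (f1 x); exact: fd.
Qed.

Lemma is_iter_dderiv V f ys : (forall x, V x -> iter_dderivable f ys x) ->
  is_iter V f ys (iter_dderiv f ys).
Proof.
elim: ys f => [|y ys IH] f //= fd; exists (dderiv f y); split.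
  move=> x /fd[[l fl] _].
  exact: (@xgetPex _ 0 [set l | is_dderiv f y x l] (ex_intro _ l fl)).
by apply: IH => x /fd[].
Qed.

Lemma is_iter_fst (W : tvsType R) V f h (ps : seq (E * W)) :
  is_iter V f (map fst ps) h ->
  is_iter (V `*` [set: W]) (f \o fst) ps (h \o fst).
Proof.
elim: ps f => [|[u w] ps IH] f /=; first by move=> fh [x v] [/= /fh].
move=> [f1 [fd i1]]; exists (f1 \o fst); split; last exact: IH.
by move=> [x v] [/= Vx _]; exact: fd.
Qed.

Lemma is_iter_slice (W : tvsType R) V (f h : E * W -> F) ys (w : W) :
  is_iter (V `*` setT) f [seq (y, 0) | y <- ys] h ->
  is_iter V (fun x => f (x, w)) ys (fun x => h (x, w)).
Proof.
elim: ys f => [|y ys IH] f /=; first by move=> fh x Vx; rewrite fh.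
move=> [f1 [fd i1]]; exists (fun x => f1 (x, w)); split; last exact: IH.
move=> x Vx; have := fd (x, w) (conj Vx I); apply: cvg_trans.
apply: near_eq_cvg; near=> t; rewrite /diff_quot.
by congr (_ *: (f _ - _)); congr pair; rewrite /= scaler0 addr0.
Unshelve. all: by end_near. Qed.

End Iter.

Definition evs (T : Type) (E : Type) (Ys : seq (T -> E)) (t : T) :=
  [seq Y t | Y <- Ys].

(** Past the end of [Ys] the default [fun=> 0] is continuous, so indices need no bound. *)
Definition all_cont_on (T : topologicalType) (E : tvsType R) (S : set T)
    (Ys : seq (T -> E)) :=
  forall i, cont_on S (nth (fun=> 0) Ys i).

(* Joint continuity in the point and the directions, for lists of a fixed
   length [j]; quantifying over continuous families avoids topologizing
   lists. *)
Definition jointly_cont (j : nat) (E F : tvsType R) (D : set E)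
    (g : E -> seq E -> F) :=
  forall (T : topologicalType) (S : set T) (X : T -> E) (Ys : seq (T -> E)),
    size Ys = j -> (forall t, S t -> D (X t)) -> cont_on S X ->
    all_cont_on S Ys -> cont_on S (fun t => g (X t) (evs Ys t)).

(** The clause of order [j] in [Cr_on], with lists in place of families indexed by ['I_j]. *)
Definition jet (j : nat) (E F : tvsType R) (D : set E) (f : E -> F) :=
  exists g : E -> seq E -> F,
    (forall ys, size ys = j -> is_iter D° f ys (g ^~ ys)) /\
    jointly_cont j D g.

Lemma interior_setXTE (X Y : topologicalType) (D : set X) :
  (D `*` [set: Y])° = D° `*` setT.
Proof.
by apply/seteqP; split=> p; [move/interior_setXT|move=> [? _];
  apply/interior_setXT].
Qed.

(** Differentiating further in [x] with [y] kept fixed means differentiating [df] at [(x, y)] along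
    directions [(z, 0)]. *)
Lemma Ck_jet k (E F : tvsType R) (D : set E) (f : E -> F) :
  hausdorff_space F -> Ck k D f -> jet k D f.
Proof.
move=> hF; elim: k E D f => [|k IH] E D f [cf Df].
  exists (fun x _ => f x); split; first by move=> [].
  by move=> T S X Ys _ SD cX _; apply: (cont_on_comp SD cX).
have [df [fd /IH[g [gi gc]]]] := Df.
exists (fun x ys => if ys is y :: ys' then g (x, y) [seq (z,
  0) | z <- ys'] else 0).
split=> [[|y ys] //= [sy]|T S X [|Y Ys] //= [sy] SD cX cYs].
  exists (fun x => df (x, y)); split; first by move=> x Dx; exact: fd.
  apply: (is_iter_slice (f := df) (h := g ^~ [seq (z, 0) | z <- ys])).
  by rewrite -interior_setXTE; apply: gi; rewrite size_map.
have cY : cont_on S Y := cYs 0%N.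
have {}cYs : all_cont_on S Ys by move=> i; exact: (cYs i.+1).
have := gc T S (fun t => (X t, Y t)) [seq (fun t => (Z t, 0)) | Z <- Ys].
rewrite size_map => /(_ sy _ _ _).
have -> : (fun t => g (X t, Y t) (evs [seq (fun t0 => (Z t0, 0)) | Z <- Ys] t))
   = (fun t => g (X t, Y t) [seq (z, 0) | z <- [seq Y0 t | Y0 <- Ys]]).
  by apply/funext => t; rewrite /evs -!map_comp.
apply => //; first by move=> t St; split => //; exact: SD.
- exact: cont_on_pair.
- move=> i; have [iY|iY] := ltnP i (size Ys).
    rewrite (nth_map (fun=> 0)) //; apply: cont_on_pair; first exact: cYs.
    by move=> t _; exact: cvg_cst.
  by rewrite nth_default ?size_map // => t _; exact: cvg_cst.
Qed.

End Jets.

Section CrOn.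
Context {R : realType}.

Lemma map_nth_ord (T : Type) (x0 : T) (s : seq T) j : size s = j ->
  [seq nth x0 s i | i : 'I_j] = s.
Proof.
move=> <-; rewrite /image_mem.
have -> : (fun i : 'I_(size s) => nth x0 s i) = nth x0 s \o val by [].
by rewrite map_comp val_enum_ord -/(mkseq _ _) mkseq_nth.
Qed.

Lemma Cr_on_jet (E F : tvsType R) (r : option nat) (D : set E) (f : E -> F) :
  hausdorff_space F ->
  Cr_on r D f <-> cont_on D f /\ forall j, le_order j r -> jet j D f.
Proof.
move=> hF; split=> [[/cont_onP cf Df]|[cf Df]]; split.
- exact: cf.
- move=> j /Df[fd [g [/cont_onP cg gE]]].
  exists (fun x s => g (x, fun i : 'I_j => nth 0 s i)); split.
    move=> ys sy; pose y (i : 'I_j) := nth 0 ys i.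
    have ysE : [seq y i | i : 'I_j] = ys by exact: map_nth_ord.
    apply: (is_iter_ext (h := iter_dderiv f ys)) => //;
      first exact: open_interior.
      by move=> x Dx; rewrite -{1}ysE gE.
    by apply: is_iter_dderiv => x Dx; rewrite -ysE; exact: fd.
  move=> T S X Ys sY SD cX cYs.
  have := @cont_on_comp _ _ _ S (D `*` setT)
    (fun t => (X t, (fun i : 'I_j => nth (fun=> 0) Ys i t) : {ptws 'I_j ->
      E})) g _ _ cg.
  have -> : (fun t => g (X t, fun i : 'I_j => nth 0 (evs Ys t) i)) =
    g \o (fun t => (X t, (fun i : 'I_j => nth (fun=> 0) Ys i t) : {ptws 'I_j
      -> E})).
    apply/funext => t /=; congr (g (_, _)); apply/funext => i.
    by rewrite /evs (nth_map (fun=> 0)) ?sY.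
  apply; first by move=> t St; split => //=; exact: SD.
  by apply: cont_on_pair => //; apply: ptws_cont_on => i; exact: cYs.
- exact/cont_onP.
- move=> j /Df[g [gi gc]]; split.
    move=> x ys Dx.
    have sy : size [seq ys i | i : 'I_j] = j
      by rewrite size_map -cardE card_ord.
    by have [] := is_iterP hF (open_interior _) (gi _ sy) Dx.
  exists (fun p => g p.1 [seq p.2 i | i : 'I_j]); split.
    apply/cont_onP.
    (* The universal family: the parameters are the point and the directions themselves, with the
       coordinate projections as [Ys]. *)
    have := @gc _ (D `*` setT) (@fst E {ptws 'I_j -> E})
      [seq (fun p : E * {ptws 'I_j -> E} => p.2 i) | i <- enum 'I_j].
    have -> : (fun t : E * {ptws 'I_j -> E} => g t.1
        (evs [seq (fun p : E * {ptws 'I_j ->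
          E} => p.2 i) | i <- enum 'I_j] t)) =
        (fun p => g p.1 [seq p.2 i | i : 'I_j]).
      by apply/funext => t; rewrite /evs -map_comp.
    apply.
    + by rewrite size_map -cardE card_ord.
    + by move=> t [].
    + by apply: continuous_cont_on; exact: fst_continuous.
    + move=> i; have [ij|ij] := ltnP i (size (enum 'I_j)); last first.
        rewrite nth_default; last by rewrite size_map.
        by move=> t _; exact: cvg_cst.
      have j0 : 'I_j by rewrite -cardE card_ord in ij; exact: Ordinal ij.
      rewrite (nth_map j0) //; apply: continuous_cont_on.
      exact: comp_continuous (@snd_continuous _ _) (@ptws_proj_continuous _ _
        _ _).
  move=> x ys Dx /=.
  have sy : size [seq ys i | i : 'I_j] = j by rewrite size_map -cardE card_ord.
  by have [_ ->] := is_iterP hF (open_interior _) (gi _ sy) Dx.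
Qed.


Lemma all_cont_on_cat (T : topologicalType) (E : tvsType R) (S : set T)
    (Ys Zs : seq (T -> E)) :
  all_cont_on S Ys -> all_cont_on S Zs -> all_cont_on S (Ys ++ Zs).
Proof. by move=> cY cZ i; rewrite nth_cat; case: ifP. Qed.

Lemma all_cont_on_seq1 (T : topologicalType) (E : tvsType R) (S : set T)
    (Y : T -> E) : cont_on S Y -> all_cont_on S [:: Y].
Proof.
by move=> cY [|i] //=; rewrite nth_nil => t _; exact: cvg_cst.
Qed.

Lemma all_cont_on_map (T : topologicalType) (E E' : tvsType R) (S : set T)
    (h : E -> E') (Ys : seq (T -> E)) :
  continuous h -> all_cont_on S Ys -> all_cont_on S [seq h \o Y | Y <- Ys].
Proof.
move=> ch cY i; have [iY|iY] := ltnP i (size Ys).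
  rewrite (nth_map (fun=> 0)) //; apply: (cont_on_comp (D' := setT)) => //.
  exact: continuous_cont_on.
rewrite nth_default; last by rewrite size_map.
by move=> t _; exact: cvg_cst.
Qed.

Lemma cont_onD (T : topologicalType) (E : tvsType R) (S : set T)
    (Y Z : T -> E) :
  cont_on S Y -> cont_on S Z -> cont_on S (fun t => Y t + Z t).
Proof. by move=> cY cZ t St; apply: tvs_cvgD; [exact: cY|exact: cZ]. Qed.

Lemma evs_cat (T E : Type) (Ys Zs : seq (T -> E)) t :
  evs (Ys ++ Zs) t = evs Ys t ++ evs Zs t.
Proof. exact: map_cat. Qed.

Lemma evs_comp (T E E' : Type) (h : E -> E') (Ys : seq (T -> E)) t :
  evs [seq h \o Y | Y <- Ys] t = map h (evs Ys t).
Proof. by rewrite /evs -!map_comp. Qed.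

(** * Iterated derivatives of the first derivative, as a function of point and direction *)

Section Leibniz.
Context {E F : tvsType R} (hF : hausdorff_space F) (D : set E) (f : E -> F).
Variables (k : nat) (g : E -> seq E -> F).
Hypothesis gi : forall ys, (size ys <= k.+1)%N -> is_iter D° f ys (g ^~ ys).
Hypothesis gc : forall j, (j <= k.+1)%N -> jointly_cont j D g.

Let oD : open D° := open_interior D.

Lemma is_iter_jet s us : (size s + size us <= k.+1)%N ->
  is_iter D° (g ^~ s) us (g ^~ (s ++ us)).
Proof.
move=> ss; have /(is_iter_cat _ _ _ _ oD)[h fh hg] : is_iter D° f (s ++ us) (g
  ^~ (s ++ us)).
  by apply: gi; rewrite size_cat.
apply: is_iter_ext hg => // x Dx.
have gs : is_iter D° f s (g ^~ s) by apply: gi;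
  exact: leq_trans (leq_addr _ _) ss.
exact: (is_iter_uniq hF oD fh gs Dx).
Qed.

Lemma is_dderiv_jet s u x : (size s < k.+1)%N -> D° x ->
  is_dderiv (g ^~ s) u x (g x (rcons s u)).
Proof.
move=> ss Dx; have [|h [gh hg]] := @is_iter_jet s [:: u].
  by rewrite addn1.
by rewrite -cats1 -hg//; exact: gh.
Qed.

Lemma jet_cont s x : (size s <= k.+1)%N -> D° x -> {for x, continuous (g ^~ s)}.
Proof.
move=> ss Dx; apply: (cont_on_open oD Dx).
have := gc ss (T := E) (S := D°) (X := id) (Ys := [seq (fun=> y) | y <- s]).
have -> : (fun t => g (id t) (evs [seq (fun=> y) | y <- s] t)) = g ^~ s.
  by apply/funext => t; rewrite /evs -map_comp map_id.
apply => //; first by rewrite size_map.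
- by move=> t; exact: interior_subset.
- by move=> t _; exact: cvg_within.
- move=> i t _; have [iY|iY] := ltnP i (size s).
    by rewrite (nth_map 0) //; exact: cvg_cst.
  rewrite nth_default; last by rewrite size_map.
  exact: cvg_cst.
Qed.

Lemma jet1_cont : cont_on (D `*` setT) (fun p => g p.1 [:: p.2]).
Proof.
apply: (@gc 1 _ (E * E)%type _ fst [:: snd]) => //.
- by move=> t [].
- by apply: continuous_cont_on; exact: fst_continuous.
- move=> [|i] /=; first by apply: continuous_cont_on; exact: snd_continuous.
  by rewrite nth_nil => t _; exact: cvg_cst.
Qed.

(** Linearity of [D_y f] in [y] holds on all of the open set [D°] and so survives differentiation
    along [s]; uniqueness of iterated derivatives gives the equation. *)
Lemma jetDZ s x (y w : E) (t : R) : (size s <= k)%N -> D° x ->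
  g x (y + t *: w :: s) = g x (y :: s) + t *: g x (w :: s).
Proof.
move=> ss Dx.
have g1 (z : E) q : D° q -> is_dderiv f z q (g q [:: z]).
  by have [h [fh hg]] := gi (ys := [:: z]) isT; move=> Dq; rewrite -hg //;
    exact: fh.
have g1D q (z1 z2 : E) : D° q -> g q [:: z1 + z2] = g q [:: z1] + g q [:: z2].
  move=> Dq; apply: (dderiv_add (f := f) (df := fun p => g p.1 [:: p.2]) (V :=
    D°)) => //.
    by move=> q' v Dq'; exact: g1.
  move=> p Dp; apply: (@cont_on_open _ _ (D° `*` setT)) => //.
    exact: open_setX oD openT.
  apply: cont_onS jet1_cont => p' [Dp' _]; split => //.
  exact: interior_subset.
have g1Z q (z : E) : D° q -> g q [:: t *: z] = t *: g q [:: z].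
  move=> Dq; apply: (dderiv_uniq hF (g1 _ _ Dq)).
  by apply: is_dderivZ; exact: g1.
have ii (z : E) : is_iter D° (g ^~ [:: z]) s (g ^~ (z :: s))
  by exact: is_iter_jet.
have i1 := is_iterD (ii y) (is_iterZ t (ii w)).
have i2 : is_iter D° (fun x => g x [:: y] + t *: g x [:: w]) s
    (g ^~ (y + t *: w :: s)).
  by apply: is_iter_ext (ii (y + t *: w)) => // q Dq; rewrite g1D // g1Z.
exact: (is_iter_uniq hF oD i2 i1 Dx).
Qed.

(** By [jetDZ] at [x + t *: u], the increment splits into one of [g ^~ (y :: s)] and [t] times
    [g (x + t *: u) (w :: s)], for which continuity is enough. *)
Lemma is_dderiv_jet_dir s (u w x y : E) : (size s < k)%N -> D° x ->
  is_dderiv (fun p => g p.1 (p.2 :: s)) (u, w) (x, y)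
    (g x (y :: rcons s u) + g x (w :: s)).
Proof.
move=> ss Dx.
have h1 : is_dderiv (g ^~ (y :: s)) u x (g x (rcons (y :: s) u)).
  by apply: is_dderiv_jet.
have h2 : (fun t : R => g (x + t *: u) (w :: s)) @ (0 : R)^' --> g x (w :: s).
  have := @jet_cont (w :: s) x (ltnW ss) Dx.
  by move=> h; apply: (cvg_comp _ _ (@cvg_line _ _ x u) h).
have := tvs_cvgD h1 h2 => /(_ _); apply: cvg_trans; apply: near_eq_cvg.
have nD : nbhs x D° by apply: open_nbhs_nbhs.
near=> t.
have t0 : t != 0 by near: t; exact: nbhs_dnbhs_neq.
have Dt : D° (x + t *: u) by near: t; exact: (@cvg_line _ _ x u _ nD).
rewrite /diff_quot /= jetDZ //; last exact: ltnW.
rewrite addrAC [RHS]scalerDr; congr (_ + _).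
by rewrite scalerA mulVf // scale1r.
Unshelve. all: by end_near. Qed.

(* The iterated derivative of [(x, y) |-> D_y f(x)] along the directions
   [(u_i, w_i)] is [D_{u_j} ... D_{u_1} D_y f(x)] plus the terms collected here,
   where one [w_i] takes the place of [y], on which [D_y f(x)] depends
   linearly. *)
Fixpoint leibniz (s : seq E) (ps : seq (E * E)) (x : E) : F :=
  if ps is p :: ps' then
    g x (p.2 :: s ++ map fst ps') + leibniz (rcons s p.1) ps' x
  else 0.

(** One derivative along [(u, w)] gives a term of the same shape with [u] appended to [s], treated
    by induction, and a term in [w] that does not depend on [y], treated by [is_iter_jet]. The bound
    is [k] and not [k.+1] because [y] takes one place. *)
Lemma is_iter_leibniz s ps : (size s + size ps <= k)%N ->
  is_iter (D° `*` setT) (fun p => g p.1 (p.2 :: s)) ps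
    (fun p => g p.1 (p.2 :: s ++ map fst ps) + leibniz s ps p.1).
Proof.
elim: ps s => [|[u w] ps IH] s /= ss; first by move=> p _; rewrite cats0 addr0.
exists (fun p => g p.1 (p.2 :: rcons s u) + g p.1 (w :: s)); split.
  move=> [x y] [/= Dx _]; apply: is_dderiv_jet_dir => //.
  by rewrite (leq_trans _ ss) // addnS ltnS leq_addr.
have i1 := IH (rcons s u) _; rewrite size_rcons addSnnS in i1.
have {}i1 := i1 ss.
have i2 : is_iter (D° `*` setT) ((g ^~ (w :: s)) \o fst) ps
    ((g ^~ (w :: s ++ map fst ps)) \o fst).
  apply: is_iter_fst; apply: (@is_iter_jet (w :: s)).
  by rewrite size_map /= addSnnS ltnW // ltnS.
apply: is_iter_ext (is_iterD i1 i2) => //.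
  exact: open_setX oD openT.
move=> [x y] _ /=; rewrite cat_rcons -!addrA; congr (_ + _).
by rewrite addrC.
Qed.

Lemma leibniz_cont (T : topologicalType) (S : set T) (X : T -> E)
    (Ss : seq (T -> E)) (Ps : seq (T -> E * E)) :
  (size Ss + size Ps <= k.+1)%N -> (forall t, S t -> D (X t)) ->
  cont_on S X -> all_cont_on S Ss -> all_cont_on S Ps ->
  cont_on S (fun t => leibniz (evs Ss t) (evs Ps t) (X t)).
Proof.
elim: Ps Ss => [|P Ps IH] Ss ss SD cX cS cP /=.
  by move=> t _; exact: cvg_cst.
have cf : all_cont_on S (snd \o P :: Ss ++ [seq fst \o Q | Q <- Ps]).
  apply: (@all_cont_on_cat _ _ _ [:: snd \o P]).
    apply: all_cont_on_seq1;
      apply: (cont_on_comp (D' := setT)) (cP 0%N) _ => //.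
    by apply: continuous_cont_on; exact: snd_continuous.
  apply: all_cont_on_cat => //; apply: all_cont_on_map.
    exact: fst_continuous.
  by move=> i; exact: (cP i.+1).
apply: cont_onD.
  have := gc _ _ SD cX cf;
    rewrite /= size_cat size_map -addnS => /(_ _ ss erefl).
  by apply: cont_on_ext => t _; rewrite evs_cat evs_comp.
have := IH (rcons Ss (fst \o P)); rewrite size_rcons addSnnS.
move=> /(_ ss SD cX) h.
have {h} : cont_on S (fun t => leibniz (evs (rcons Ss (fst \o P)) t) (evs Ps
  t) (X t)).
  apply: h; last by move=> i; exact: (cP i.+1).
  rewrite -cats1; apply: all_cont_on_cat => //.
  apply: all_cont_on_seq1; apply: (cont_on_comp (D' := setT)) (cP 0%N) _ => //.
  by apply: continuous_cont_on; exact: fst_continuous.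
by apply: cont_on_ext => t _; rewrite /evs map_rcons.
Qed.

Lemma jet_deriv j : (j <= k)%N ->
  jet j (D `*` setT) (fun p : E * E => g p.1 [:: p.2]).
Proof.
move=> jk; exists (fun p ps => g p.1 (p.2 :: map fst ps) + leibniz [::] ps p.1).
split=> [ps sp|T S X Ps sP SD cX cP].
  rewrite interior_setXTE; apply: (@is_iter_leibniz [::] ps).
  by rewrite sp.
have SD1 t : S t -> D (X t).1 by move=> /SD[].
have cX1 : cont_on S (fst \o X).
  apply: (cont_on_comp (D' := setT)) cX _ => //.
  by apply: continuous_cont_on; exact: fst_continuous.
apply: cont_onD; last first.
  by apply: (@leibniz_cont T S (fst \o X) [::] Ps) => //;
    [rewrite sP ltnW|move=> i; rewrite nth_nil => t _; exact: cvg_cst].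
have cf : all_cont_on S (snd \o X :: [seq fst \o Q | Q <- Ps]).
  apply: (@all_cont_on_cat _ _ _ [:: snd \o X]).
    apply: all_cont_on_seq1; apply: (cont_on_comp (D' := setT)) cX _ => //.
    by apply: continuous_cont_on; exact: snd_continuous.
  by apply: all_cont_on_map => //; exact: fst_continuous.
have := gc _ _ SD1 cX1 cf; rewrite /= size_map sP => /(_ j.+1 jk erefl).
by apply: cont_on_ext => t _; rewrite evs_comp.
Qed.

Lemma jet1_dderiv x y : D° x -> is_dderiv f y x (g x [:: y]).
Proof.
have [h [fh hg]] := gi (ys := [:: y]) isT.
by move=> Dx; rewrite -hg //; exact: fh.
Qed.

End Leibniz.

Lemma jet_Ck k (E F : tvsType R) (D : set E) (f : E -> F) :
  hausdorff_space F -> cont_on D f ->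
  (forall j, (j <= k)%N -> jet j D f) -> Ck k D f.
Proof.
move=> hF; elim: k E D f => [|k IH] E D f cf Df; first by split.
(* The extensions given for the various orders are chosen separately; the length of the list selects
   which of them [g] uses. *)
have /choice[G GP] : forall j, exists g : E -> seq E -> F, (j <= k.+1)%N ->
    (forall ys, size ys = j -> is_iter D° f ys (g ^~ ys)) /\
    jointly_cont j D g.
  move=> j; case: (leqP j k.+1) => [/Df[g gP]|_]; first by exists g.
  by exists (fun _ _ => 0).
pose g x s := G (size s) x s.
have gi ys : (size ys <= k.+1)%N -> is_iter D° f ys (g ^~ ys).
  by move=> /GP[/(_ _ erefl)].
have gc j : (j <= k.+1)%N -> jointly_cont j D g.
  move=> /GP[_ Gc] T S X Ys sY SD cX cY; have := Gc T S X Ys sY SD cX cY.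
  by apply: cont_on_ext => t _; rewrite /g size_map sY.
split => //; exists (fun p => g p.1 [:: p.2]); split.
  by move=> x y Dx; exact: (jet1_dderiv gi).
apply: IH; first exact: jet1_cont gc.
by move=> j jk; exact: (jet_deriv hF gi gc jk).
Qed.

Lemma Cr_onP (E F : tvsType R) (r : option nat) (D : set E) (f : E -> F) :
  hausdorff_space F ->
  Cr_on r D f <-> forall k, le_order k r -> Ck k D f.
Proof.
move=> hF; rewrite Cr_on_jet //; split=> [[cf Df] k kr|Df].
  by apply: jet_Ck => // j jk; apply: Df; case: r kr => //= n; exact: leq_trans.
split; last by move=> j jr; apply: Ck_jet => //; exact: Df.
by apply: (@Ck_cont _ 0%N); apply: Df; case: (r).
Qed.

End CrOn.

(** * Smooth cutoff functions *)

Section Bump.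
Context {R : realType}.

(** [x^-n * exp (-1/x)], extended by 0. The whole family is needed because differentiating [flat n]
    leads to [flat n.+2] and [flat n.+1]. *)
Definition flat (n : nat) (x : R^o) : R^o :=
  if 0 < x then x^-1 ^+ n * expR (- x^-1) else 0.

Lemma flat_ge0 n x : 0 <= flat n x.
Proof.
rewrite /flat; case: ifP => // x0.
by rewrite mulr_ge0 ?expR_ge0 // exprn_ge0 // invr_ge0 ltW.
Qed.

(** With [u = 1/x], [exp u] is at least [u ^ (n+1) / (n+1)!]. This gives continuity at 0 for every
    [n]. *)
Lemma flat_le n (x : R) : `|flat n x| <= (n.+1)`!%:R * `|x|.
Proof.
rewrite ger0_norm ?flat_ge0 // /flat; case: ifP => [x0|_]; last first.
  by rewrite mulr_ge0.
have u0 : 0 < x^-1 by rewrite invr_gt0.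
rewrite gtr0_norm // expRN ler_pdivrMr ?expR_gt0 // mulrAC -ler_pdivrMr //.
rewrite -exprSr mulrC -ler_pdivrMr ?ltr0n ?fact_gt0 //.
by rewrite (le_trans _ (expR_ge1Dxn n (ltW u0))) // lerDr.
Qed.

Lemma flat_near_pos n (x : R) : 0 < x ->
  \forall y \near x, (y^-1) ^+ n * expR (- y^-1) = flat n y.
Proof.
move=> x0; near=> y; rewrite /flat ifT //.
by near: y; exact: lt_nbhsr.
Unshelve. all: by end_near. Qed.

Lemma flat_near_neg n (x : R) : x < 0 -> \forall y \near x, 0 = flat n y.
Proof.
move=> x0; near=> y; rewrite /flat ltNge ifF //; apply/negbTE; rewrite negbK.
by apply/ltW; near: y; exact: lt_nbhsl.
Unshelve. all: by end_near. Qed.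

Lemma is_derive_dderiv (f : R -> R) (x l : R) :
  is_derive x 1 f l -> @is_dderiv R R^o R^o f 1 x l.
Proof.
move=> [df <-]; move: df; rewrite /derivable /derive => df.
apply: cvg_trans df; apply: near_eq_cvg; near=> t.
by rewrite /diff_quot /= (addrC x).
Unshelve. all: by end_near. Qed.

Lemma flat_cvg0 n : flat n t @[t --> (0 : R)] --> (0 : R).
Proof.
apply/cvgrPdist_lt => e e0; near=> t.
rewrite sub0r normrN (le_lt_trans (flat_le n t)) // mulrC -ltr_pdivlMr;
  last first.
  by rewrite ltr0n fact_gt0.
near: t; exists (e / (n.+1)`!%:R) => /=; last first.
  by move=> t /=; rewrite sub0r normrN.
by rewrite divr_gt0 // ltr0n fact_gt0.
Unshelve. all: by end_near. Qed.

Lemma flat_deriv n (x : R) :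
  @is_dderiv R R^o R^o (flat n) 1 x (flat n.+2 x - n%:R * flat n.+1 x).
Proof.
have [x0|x0|->] := ltgtP x 0.
- have f0 m : flat m x = 0 by rewrite -(nbhs_singleton (flat_near_neg m x0)).
  rewrite !f0 mulr0 subrr; apply: is_dderiv_near (flat_near_neg n x0) _.
  by apply: (@is_derive_dderiv (cst 0)).
- have h : is_derive x 1 (fun y : R => (y^-1) ^+ n * expR (- y^-1))
      (flat n.+2 x - n%:R * flat n.+1 x).
    have x_neq0 : x != 0 by rewrite gt_eqF.
    have h1 : is_derive x 1 (fun y : R => y^-1) (- x ^- 2 *: (1 : R)).
      exact: (@is_deriveV _ id).
    have h2 : is_derive x 1 (fun y : R => expR (- y^-1))
        (expR (- x^-1) * - (- x ^- 2 *: (1 : R))).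
      by apply: (@is_derive1_comp _ expR (fun y : R => - y^-1)).
    have h3 := is_deriveM (is_deriveX n h1) h2.
    have fE : GRing.inv ^+ n * (fun y : R => expR (- y^-1)) =
        (fun y : R => (y^-1) ^+ n * expR (- y^-1)).
      by apply/funext => y; rewrite !fctE.
    rewrite -fE; apply: is_derive_eq h3 _.
    rewrite /flat x0 !fctE /GRing.scale /= -exprVn.
    case: n {fE} => [|n] /=; first by ring.
    by rewrite !exprS; move: (_ ^+ n) n.+1%:R => p c; ring.
  apply: is_dderiv_near (is_derive_dderiv h).
  exact: flat_near_pos.
(* At 0 the difference quotient of [flat n] is [flat n.+1], which tends to 0. *)
- have -> : flat n.+2 0 - n%:R * flat n.+1 0 = 0.
    by rewrite /flat ltxx mulr0 subr0.
  have h : flat n.+1 t @[t --> (0 : R)^'] --> (0 : R).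
    by apply: cvg_trans (flat_cvg0 n.+1); apply: cvg_app; exact: nbhs_dnbhs.
  apply: cvg_trans h; apply: near_eq_cvg; near=> t.
  rewrite /diff_quot add0r /GRing.scale /= mulr1 {3}/flat ltxx subr0 /flat.
  by case: ifP => _; rewrite ?mulr0 // mulrA -exprS.
Unshelve. all: by end_near. Qed.

Lemma flat_cont n : continuous (flat n).
Proof.
move=> x; have [x0|x0|->] := ltgtP (x : R) 0.
- rewrite /continuous_at -(nbhs_singleton (flat_near_neg n x0)).
  have h : (fun=> 0 : R) @ x --> (0 : R) by exact: cvg_cst.
  by apply: cvg_trans h; apply: near_eq_cvg; exact: flat_near_neg.
- rewrite /continuous_at -(nbhs_singleton (flat_near_pos n x0)).
  have hV : (fun y : R => y^-1) @ x --> (x^-1 : R).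
    by apply: (cvgV _ (@cvg_id _ _)); rewrite gt_eqF.
  have h : (fun y : R => (y^-1) ^+ n * expR (- y^-1)) @ x -->
      ((x^-1) ^+ n * expR (- x^-1) : R).
    apply: cvgM.
      exact: (cvg_comp _ _ hV (@exprn_continuous R n _)).
    exact: (cvg_comp _ _ (cvgN hV) (@continuous_expR R _)).
  by apply: cvg_trans h; apply: near_eq_cvg; exact: flat_near_pos.
- by rewrite /continuous_at {2}/flat ltxx; exact: flat_cvg0.
Qed.

Lemma flat_Ck k n : @Ck R k R^o R^o setT (flat n).
Proof.
elim: k n => [|k IH] n; (split; first by apply: continuous_cont_on;
  exact: flat_cont) => //.
exists (fun p => p.2 *: (flat n.+2 p.1 - n%:R * flat n.+1 p.1)); split.
  move=> x y _; have := is_dderivZ (a := y) (flat_deriv (n := n) (x := x)).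
  by rewrite [y *: 1]mulr1.
rewrite setXTT; apply: Ck_scale; first exact: Ck_snd.
have -> : (fun p : R^o * R^o => flat n.+2 p.1 - n%:R * flat n.+1 p.1 : R^o) =
   (fun p : R^o * R^o => flat n.+2 p.1 + (- n%:R : R^o) *: flat n.+1 p.1).
  by apply/funext => p; rewrite /GRing.scale /= mulNr.
apply: Ck_add.
  exact: (Ck_compT (Ck_fst _ _) (IH _)).
apply: Ck_scale; first exact: Ck_cst.
exact: (Ck_compT (Ck_fst _ _) (IH _)).
Qed.

(* The numerator is constant for [x <= 0] and vanishes as soon as
   [flat 0 1 <= flat 0 x]. *)
Definition smooth_step (x : R^o) : R^o :=
  flat 0 (flat 0 1 - flat 0 x) / flat 0 (flat 0 1).

Lemma flat0_homo : {homo flat 0 : x y / x <= y}.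
Proof.
move=> x y xy; rewrite {1}/flat; case: ifP => [x0|_]; last exact: flat_ge0.
have y0 : 0 < y by exact: lt_le_trans xy.
rewrite /flat y0 !expr0 !mul1r ler_expR lerN2 lef_pV2 //.
Qed.

Lemma flat01_gt0 : 0 < flat 0 1.
Proof. by rewrite /flat ltr01 mulr_gt0 ?expR_gt0 // exprn_gt0 // invr1. Qed.

Lemma flat0c_gt0 : 0 < flat 0 (flat 0 1).
Proof.
by rewrite {1}/flat flat01_gt0 mulr_gt0 ?expR_gt0 // exprn_gt0 // invr_gt0
  flat01_gt0.
Qed.

Lemma smooth_step1 x : x <= 0 -> smooth_step x = 1.
Proof.
move=> x0; rewrite /smooth_step;
  have -> : flat 0 x = 0 by rewrite /flat ltNge x0.
by rewrite subr0 divff // gt_eqF // flat0c_gt0.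
Qed.

Lemma smooth_step0 x : 1 <= x -> smooth_step x = 0.
Proof.
move=> x1; rewrite /smooth_step {1}/flat ltNge subr_le0 flat0_homo //.
by rewrite mul0r.
Qed.

Lemma smooth_step_ge0 x : 0 <= smooth_step x.
Proof. by rewrite divr_ge0 // flat_ge0. Qed.

Lemma smooth_step_le1 x : smooth_step x <= 1.
Proof.
rewrite ler_pdivrMr ?flat0c_gt0 // mul1r; apply: flat0_homo.
by rewrite lerBlDr lerDl flat_ge0.
Qed.

Lemma smooth_step_Ck k : @Ck R k R^o R^o setT smooth_step.
Proof.
have -> : smooth_step = (fun x : R^o => ((flat 0 (flat 0 1))^-1 : R^o) *:
    (flat 0 \o (fun x : R^o => flat 0 1 + (- 1 : R^o) *: flat 0 x)) x).
  by apply/funext => x; rewrite /smooth_step /GRing.scale /= mulN1r mulrC.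
apply: Ck_scale; first exact: Ck_cst.
apply: Ck_compT; last exact: flat_Ck.
apply: Ck_add; first exact: Ck_cst.
by apply: Ck_scale; [exact: Ck_cst|exact: flat_Ck].
Qed.

End Bump.

(** * Sublinear functionals, the Hahn-Banach theorem and separation of points *)

Section HahnBanach.
Context {R : realType}.

Lemma inf_image_le (I : Type) (P : set I) (h : I -> R) (b : R) i :
  (forall j, P j -> b <= h j) -> P i -> inf (h @` P) <= h i.
Proof.
by move=> bh Pi; apply: ge_inf; [exists b => _ [j Pj <-]; exact: bh|exists i].
Qed.

Lemma le_inf_image (I : Type) (P : set I) (h : I -> R) (b : R) i :
  P i -> (forall j, P j -> b <= h j) -> b <= inf (h @` P).
Proof.
by move=> Pi bh; apply: lb_le_inf; [exists (h i); exists i|move=> _ [j Pj <-];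
  exact: bh].
Qed.

Section Sublinear.
Context {E : lmodType R}.
Implicit Types (p q : E -> R).

(** The inequality for positive [t] suffices: applied to [t^-1] as well, it gives equality, and
    [p 0 = 0] follows. *)
Definition sublinear p := (forall t x, 0 < t -> p (t *: x) <= t * p x) /\
  (forall x y, p (x + y) <= p x + p y).

Lemma sublinear0 p : sublinear p -> p 0 = 0.
Proof.
move=> [pZ pD]; apply/eqP; rewrite eq_le; apply/andP; split.
  have := pZ (1 / 2) 0; rewrite scaler0 => /(_ _);
    have h : (0 : R) < 1 / 2 by lra.
  by move=> /(_ h); lra.
by have := pD 0 0; rewrite addr0; lra.
Qed.

Lemma sublinearN p x : sublinear p -> - p (- x) <= p x.
Proof.
move=> sp; have [_ /(_ x (- x))] := sp.
by rewrite subrr sublinear0 //; lra.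
Qed.

Lemma sublinearZ p t x : sublinear p -> 0 <= t -> p (t *: x) = t * p x.
Proof.
move=> sp; rewrite le_eqVlt => /orP[/eqP<-|t0].
  by rewrite scale0r mul0r sublinear0.
have [pZ _] := sp; apply/eqP; rewrite eq_le pZ //=.
have ti0 : 0 < t^-1 by rewrite invr_gt0.
have := pZ t^-1 (t *: x) ti0.
by rewrite scalerA mulVf ?gt_eqF // scale1r -ler_pdivrMl // invrK.
Qed.

(** [q x] is the infimum of [p (x + t *: z) - t * p z] over [t >= 0]. Subadditivity bounds it below
    by [- p (- x)]; [t = 0] gives [q <= p], and [t = 1] the bound at [- z]. *)
Lemma sublinear_shift p z : sublinear p ->
  exists q, [/\ sublinear q, forall x, q x <= p x & q (- z) <= - p z].
Proof.
move=> sp; have [pZ pD] := sp.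
pose h x t := p (x + t *: z) - t * p z.
have hb x t : 0 <= t -> - p (- x) <= h x t.
  move=> t0; rewrite /h -sublinearZ //.
  have := pD (x + t *: z) (- x); rewrite addrAC subrr add0r; lra.
pose T0 := [set t : R | 0 <= t].
have T00 : T0 0 by rewrite /T0 /=.
pose q x := inf (h x @` T0).
have qh x t : 0 <= t -> q x <= h x t.
  by move=> t0; apply: (inf_image_le (b := - p (- x))) => // j; exact: hb.
have hq x b : (forall t, 0 <= t -> b <= h x t) -> b <= q x.
  by move=> bh; apply: (le_inf_image (i := 0)).
exists q; split.
- split=> [c x c0|x y].
    rewrite -ler_pdivrMl //; apply: hq => t t0.
    rewrite ler_pdivrMl //; apply: le_trans (qh _ (c * t) _) _.
      by rewrite mulr_ge0 // ltW.
    rewrite /h -scalerA -scalerDr mulrBr mulrA lerB //; exact: pZ.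
  rewrite -lerBlDr; apply: (hq) => s s0; rewrite lerBlDr -lerBlDl.
  apply: hq => t t0; rewrite lerBlDl.
  apply: le_trans (qh _ (s + t) (addr_ge0 s0 t0)) _.
  rewrite /h scalerDl addrACA mulrDl.
  by have := pD (x + s *: z) (y + t *: z); lra.
- move=> x; apply: le_trans (qh x 0 (lexx _)) _.
  by rewrite /h scale0r addr0 mul0r subr0.
- apply: le_trans (qh (- z) 1 ler01) _.
  by rewrite /h scale1r addNr sublinear0 // mul1r sub0r.
Qed.

Lemma sublinear_min p0 : sublinear p0 ->
  exists p, [/\ sublinear p, forall x, p x <= p0 x &
    forall q, sublinear q -> (forall x, q x <= p x) -> q = p].
Proof.
move=> sp0.
pose T := {p | sublinear p /\ forall x, p x <= p0 x}.
(* The order is reversed, so that Zorn's lemma gives a minimal functional; a nonempty chain is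
   bounded by its pointwise infimum, finite because of the lower bound [- p0 (- x)]. *)
pose le_T (s t : T) := `[< forall x, sval t x <= sval s x >].
have [| | | |[p [sp pp0]] pmin] := @Zorn T le_T.
- by move=> t; apply/asboolP.
- move=> r s t /asboolP rs /asboolP st; apply/asboolP => x.
  exact: le_trans (st x) (rs x).
- move=> [s Ps] [t Pt] /asboolP /= st /asboolP /= ts.
  have e : s = t by apply/funext => x; apply/eqP; rewrite eq_le st ts.
  by subst t; congr exist; exact: Prop_irrelevance.
- move=> A tot; have [[s0 As0]|A0] := pselect (exists s, A s); last first.
    exists (exist _ p0 (conj sp0 (fun x => lexx _))) => s As.
    by exfalso; apply: A0; exists s.
  pose q x := inf ((fun s : T => sval s x) @` A).
  have lb x s : A s -> - p0 (- x) <= sval s x.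
    move=> _; case: s => s [ss sp] /=.
    by apply: le_trans (sublinearN x ss); rewrite lerN2.
  have qs x s : A s -> q x <= sval s x.
    by move=> As; apply: (inf_image_le (b := - p0 (- x))) => // j; exact: lb.
  have sq x b : (forall s, A s -> b <= sval s x) -> b <= q x.
    by move=> bs; apply: (le_inf_image (i := s0)).
  have sq' : sublinear q.
    split=> [c x c0|x y].
      rewrite -ler_pdivrMl //; apply: sq => s As; rewrite ler_pdivrMl //.
      by apply: le_trans (qs _ s As) _; case: s {As} => s [[sZ _] _] /=;
        exact: sZ.
    rewrite -lerBlDr; apply: (sq) => s As; rewrite lerBlDr -lerBlDl.
    apply: sq => t At; rewrite lerBlDl.
    (* Subadditivity of the infimum needs one member of the chain below both [s] and [t]; here
       totality enters. *)
    have [u [Au us ut]] : exists u, [/\ A u, forall x, sval u x <= sval s x &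
        forall x, sval u x <= sval t x].
      by have [/asboolP st|/asboolP ts] := tot s t As At; [exists t|exists s].
    apply: le_trans (qs _ u Au) _; apply: le_trans (lerD (us x) (ut y)).
    by case: u {Au us ut} => u [[_ uD] _] /=; exact: uD.
  have qp0 x : q x <= p0 x.
    by apply: le_trans (qs x s0 As0) _; case: (s0) => s [_ ] /=.
  by exists (exist _ q (conj sq' qp0)) => s As; apply/asboolP => x /=;
    exact: qs.
exists p; split => // q sq qp.
have qp0 x : q x <= p0 x by exact: le_trans (qp x) (pp0 x).
have := pmin (exist _ q (conj sq qp0)) => /(_ _).
by move=> h; have [] := h (asboolT qp).
Qed.

(* A minimal sublinear functional [p] is linear: by minimality,
   [sublinear_shift] gives [p (- x) <= - p x]. *)
Lemma sublinear_extension p0 z : sublinear p0 ->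
  exists l : E -> R, [/\ forall t x y, l (x + t *: y) = l x + t * l y,
    forall x, l x <= p0 x & p0 z <= l z].
Proof.
(* Shifting by [z] before minimizing forces [p (- z) <= - p0 z], that is, [p0 z <= p z] once [p] is
   known to be odd. *)
move=> /(sublinear_shift z)[p1 [/sublinear_min[p [sp pp1 pmin]] p10 p1z]].
have pN x : p (- x) = - p x.
  apply/eqP; rewrite eq_le; apply/andP; split; last first.
    by have := sublinearN x sp; lra.
  by have [q [sq qp qx]] := sublinear_shift x sp; move: qx;
    rewrite (pmin q sq qp).
have pD x y : p (x + y) = p x + p y.
  apply/eqP; rewrite eq_le; apply/andP; split; first by case: sp.
  by have [_ /(_ (- x) (- y))] := sp; rewrite -opprD !pN; lra.
have pZ t x : p (t *: x) = t * p x.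
  have [t0|t0] := leP 0 t; first exact: sublinearZ.
  have := @sublinearZ p (- t) x sp; rewrite scaleNr pN => h.
  by apply/eqP; rewrite -eqr_opp -mulNr h // oppr_ge0 ltW.
exists p; split; first by move=> t x y; rewrite pD pZ.
- by move=> x; exact: le_trans (pp1 x) (p10 x).
- by rewrite -lerN2 -pN; exact: le_trans (pp1 _) p1z.
Qed.

End Sublinear.

Lemma scale_cvg0 (E : tvsType R) (x : E) : (fun t : R => t *: x) @ (0 : R) -->
  (0 : E).
Proof.
rewrite -(scale0r x); apply: tvs_cvgZ; first exact: cvg_id.
exact: cvg_cst.
Qed.

(** The Minkowski functional of [Q]. Subadditivity is convexity with weights [s / (s + t)] and
    [t / (s + t)]; a value below 1 puts [x] on a segment from 0 to a point of [Q]. *)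
Lemma gauge_sublinear (E : tvsType R) (Q : set E) : cvx Q -> nbhs 0 Q ->
  exists p : E -> R, [/\ sublinear p, forall x, Q x -> p x <= 1 &
    forall x, ~ Q x -> 1 <= p x].
Proof.
move=> cQ Q0; pose P x := [set t : R | 0 < t /\ Q (t^-1 *: x)].
have Pn x : exists t, P x t.
  have [e /= e0 eQ] := @scale_cvg0 _ x _ Q0.
  have e2 : 0 < e / 2 by rewrite divr_gt0.
  exists (e / 2)^-1; split; first by rewrite invr_gt0.
  rewrite invrK; apply: eQ; rewrite /= sub0r normrN gtr0_norm //; lra.
pose p x := inf (id @` P x).
have pt x t : P x t -> p x <= t.
  by apply: (@inf_image_le _ (P x) id 0) => j [/ltW].
have tp x b : (forall t, P x t -> b <= t) -> b <= p x.
  by have [t0 Pt0] := Pn x; exact: (@le_inf_image _ (P x) id b t0).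
exists p; split.
- split=> [c x c0|x y].
    rewrite -ler_pdivrMl //; apply: tp => t [t0 Qt]; rewrite ler_pdivrMl //.
    apply: pt; split; first exact: mulr_gt0.
    by rewrite scalerA invfM mulrAC mulVf ?gt_eqF // mul1r.
  rewrite -lerBlDr; apply: (tp) => s [s0 Qs]; rewrite lerBlDr -lerBlDl.
  apply: tp => t [t0 Qt]; rewrite lerBlDl; apply: pt; split.
    exact: addr_gt0.
  have st0 : s + t != 0 by rewrite gt_eqF // addr_gt0.
  have := cQ _ _ (s / (s + t)) Qs Qt.
  have -> : 1 - s / (s + t) = t / (s + t) by field.
  rewrite !scalerA -!mulrA ![(s + t)^-1 * _]mulrC !mulrA !mulfV ?gt_eqF //
    !mul1r.
  rewrite -scalerDr; apply.
    by rewrite divr_ge0 // ltW // addr_gt0.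
  by rewrite ler_pdivrMr ?addr_gt0 // mul1r lerDl ltW.
- by move=> x Qx; apply: pt; split => //; rewrite invr1 scale1r.
- move=> x nQx; apply: tp => t [t0 Qt]; rewrite leNgt; apply/negP => t1.
  apply: nQx; have := cQ _ _ t Qt (nbhs_singleton Q0) (ltW t0) (ltW t1).
  by rewrite scaler0 addr0 scalerA mulfV ?gt_eqF // scale1r.
Qed.

(** [Q] may fail to be symmetric, so [y - x] and [x - y] are both controlled. This serves linear
    functionals and the gauge itself. *)
Lemma sublinear_dominated_continuous (E : tvsType R) (p f : E ->
  R) (Q : set E) :
  sublinear p -> nbhs 0 Q -> (forall x, Q x -> p x <= 1) ->
  (forall x y, f x - f y <= p (x - y)) -> continuous (f : E -> R^o).
Proof.
move=> sp nQ p1 fp x; apply/cvgrPdist_le => e e0.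
have hQ (a : R) : \forall y \near x, Q (a *: (y - x)).
  have h : (fun y : E => a *: (y - x)) @ x --> (0 : E).
    rewrite -(scaler0 _ a) -(subrr x); apply: tvs_cvgZ; first exact: cvg_cst.
    by apply: tvs_cvgB; [exact: cvg_id|exact: cvg_cst].
  exact: h nQ.
near=> y.
have h1 : Q (e^-1 *: (y - x)) by near: y; exact: (hQ e^-1).
have h2 : Q (e^-1 *: (x - y)).
  by rewrite -[x - y]opprB scalerN -scaleNr; near: y; exact: (hQ (- e^-1)).
have ei0 : 0 <= e^-1 by rewrite invr_ge0 ltW.
have := p1 _ h1; have := p1 _ h2.
rewrite !sublinearZ // !ler_pdivrMl // mulr1 => le1 le2.
by rewrite ler_norml; apply/andP; split; have := fp x y; have := fp y x; lra.
Unshelve. all: by end_near. Qed.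

(** The gauge of a convex neighbourhood of 0 that misses [z] is at least 1 at [z]; a linear
    functional below it and as large at [z] does not vanish there. *)
Lemma tvs_separates_points (E : tvsType R) (z : E) : hausdorff_space E ->
  z != 0 ->
  exists l : E -> R^o, [/\ continuous l,
    forall t x y, l (x + t *: y) = l x + t *: l y & l z != 0].
Proof.
move=> hE z0.
have [U [U0 nUz]] : exists U, nbhs (0 : E) U /\ ~ U z.
  apply: contrapT => h; move/eqP: z0; apply; apply/esym; apply: hE.
  move=> A B A0 Bz; exists z; split; last exact: nbhs_singleton.
  by apply: contrapT => nAz; apply: h; exists A.
have [Q [oQ Q0 QU cQ]] := cvx_nbhs U0.
have nQ : nbhs (0 : E) Q by apply: open_nbhs_nbhs.
have [p [sp p1 p2]] := gauge_sublinear cQ nQ.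
have [l [ll lp lz]] := sublinear_extension z sp.
have pz : 1 <= p z by apply: p2 => /QU.
exists l; split => //; last by rewrite gt_eqF //; lra.
have l0 : l 0 = 0.
  by have := ll 1 0 0; rewrite scaler0 addr0 mul1r; lra.
have lD x y : l (x + y) = l x + l y by have := ll 1 x y; rewrite scale1r mul1r.
have lZ t x : l (t *: x) = t * l x by have := ll t 0 x; rewrite !add0r l0 add0r.
have lN x : l (- x) = - l x by rewrite -scaleN1r lZ mulN1r.
apply: (sublinear_dominated_continuous sp nQ p1) => x y.
by rewrite -lN -lD; exact: lp.
Qed.

End HahnBanach.

(** * Locally compact rough manifolds and vector-valued C^r-maps on them *)

Section LocallyCompact.
Context {M : topologicalType} (hM : hausdorff_space M).
Hypothesis hlc : locally_compact [set: M].

Lemma compact_nbhs (x : M) (N : set M) : nbhs x N ->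
  exists C, [/\ compact C, closed C, nbhs x C & C `<=` N].
Proof.
move=> Nx; have [U] := hlc (x := x) I; rewrite withinET => Ux [cU clU].
have [V Vx VN] := compact_regular hM cU Ux Nx.
exists (closure V `&` U); split.
- apply: (subclosed_compact _ cU) => [|y []//].
  by apply: closedI => //; exact: closed_closure.
- by apply: closedI => //; exact: closed_closure.
- by apply: filterI => //; apply: filterS Vx; exact: subset_closure.
- by move=> y [/VN].
Qed.

End LocallyCompact.

Lemma open_setI_preim (X Y : topologicalType) (V : set X) (f : X -> Y)
    (W : set Y) : open V -> cont_on V f -> open W -> open (V `&` f @^-1` W).
Proof.
move=> oV cf oW; rewrite openE => x [Vx Wfx].
have nV : nbhs x V by apply: open_nbhs_nbhs.
have h : nbhs x (f @^-1` W).
  by apply: (cont_on_open oV Vx cf); apply: open_nbhs_nbhs.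
exact: filterI.
Qed.

Section Charts.
Context {R : realType} {M : topologicalType} {E : tvsType R} (phi : chart M E).

Lemma chart_image_open (V : set M) : open V -> V `<=` chart_dom phi ->
  exists2 W, open W & phi @` V = chart_codom phi `&` W.
Proof.
move=> oV VU.
have /cont_onP ci := @chart_inv_continuous _ _ _ phi.
exists [set y | chart_codom phi y -> V (chart_inv phi y)]°.
  exact: open_interior.
apply/seteqP; split=> [_ [x Vx <-]|y [[x Ux <-]]].
  have Ux : chart_codom phi (phi x) by exists x => //; exact: VU.
  split => //; apply: (ci (phi x) Ux).
  by rewrite chart_mapK; [exact: open_nbhs_nbhs|exact: VU].
move/interior_subset => /= /(_ _); rewrite chart_mapK // => h.
by exists x => //; apply: h; exists x.
Qed.

Lemma chart_image_regular (V : set M) : open V -> V `<=` chart_dom phi ->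
  regular_set (phi @` V).
Proof.
move=> oV /(chart_image_open oV)[W oW ->].
by apply: regular_setI_open => //; exact: chart_regular.
Qed.

(** The image of [V] is relatively open in [chart_codom phi], so a point of it that is interior to
    the image of any [D] is interior to the image of [V] too. This supplies the interior condition
    of [Ck_comp] for transition maps. *)
Lemma chart_image_interior (V D : set M) y : open V ->
  V `<=` chart_dom phi -> D `<=` chart_dom phi ->
  (phi @` D)° y -> (phi @` V) y -> (phi @` V)° y.
Proof.
move=> oV VU DU Dy Vy; have [W oW VE] := chart_image_open oV VU.
rewrite VE in Vy *; apply/interiorI_open => //; first by case: Vy.
by apply: filterS Dy => _ [x Dx <-]; exists x => //; exact: DU.
Qed.

End Charts.

Definition Ckr (R : realType) (r : option nat) (E F : tvsType R) (D : set E)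
  (f : E -> F) := forall k, le_order k r -> Ck k D f.

Section Smooth.
Context {R : realType} {M : topologicalType}.
Variables (r : option nat) (A : rough_chart R M -> Prop).
Hypothesis hA : is_rough_manifold r A.

Definition Cr_at (F : tvsType R) (f : M -> F) (x : M) :=
  forall phi : rough_chart R M, A phi -> chart_dom phi x ->
  exists V, [/\ open V, V x, V `<=` chart_dom phi &
    Ckr r (phi @` V) (f \o chart_inv phi)].

(** One chart is enough: in another one, [f] gets composed with a transition map, and the
    preservation of interior points in [Cr_transition] is what [Ck_comp] asks for. *)
Lemma Cr_at1 (F : tvsType R) (f : M -> F) (x : M) (phi : rough_chart R M) V :
  A phi -> open V -> V x -> V `<=` chart_dom phi ->
  Ckr r (phi @` V) (f \o chart_inv phi) -> Cr_at f x.
Proof.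
move=> Aphi oV Vx VU fk psi Apsi psix.
have [_ _ /(_ psi phi Apsi Aphi)[tk ti] _] := hA.
pose D := chart_dom psi `&` chart_dom phi.
pose V' := V `&` chart_dom psi.
have oV' : open V' by apply: openI => //; exact: chart_dom_open.
have V'D : V' `<=` D by move=> y [/VU].
have V'U : V' `<=` chart_dom psi by move=> y [].
have DU : D `<=` chart_dom psi by move=> y [].
exists V'; split => // k kr.
apply: (@Ck_ext _ _ _ _ _ ((f \o chart_inv phi) \o (phi \o chart_inv psi))).
  move=> _ /set_mem [y [Vy psiy] <-] /=.
  by rewrite !chart_mapK //; exact: VU.
have V'i y : V' y -> (phi \o chart_inv psi) (psi y) = phi y.
  by move=> [_ ?] /=; rewrite chart_mapK.
apply: Ck_comp (fk k kr).
- by move=> _ [y V'y <-]; rewrite V'i //; exists y => //; case: V'y.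
- move=> z zi; have [y V'y yz] := interior_subset zi.
  apply: (chart_image_interior (D := D)) => //; first by move=> ? [].
    apply: ti; exists z => //; apply: interiorS zi => _ [u V'u <-].
    by exists u => //; exact: V'D.
  by rewrite -yz V'i //; exists y => //; case: V'y.
- have := (Cr_onP r (psi @` D) (phi \o chart_inv psi)
    (@rough_model_hausdorff _ _ phi)).1 tk k kr.
  by apply: CkS => _ [y V'y <-]; exists y => //; exact: V'D.
Qed.

Lemma Cr_at_chart (phi : rough_chart R M) x : A phi -> chart_dom phi x ->
  Cr_at phi x.
Proof.
move=> Aphi phix; have oU := @chart_dom_open _ _ _ phi.
apply: (Cr_at1 Aphi oU phix) => // k kr.
apply: (@Ck_ext _ _ _ _ _ idfun); last by apply: Ck_linear => // y;
  exact: cvg_id.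
by move=> _ /set_mem [y Vy <-] /=; rewrite chart_mapK.
Qed.

Lemma Cr_at_near (F : tvsType R) (f g : M -> F) x :
  (\forall y \near x, f y = g y) -> Cr_at f x -> Cr_at g x.
Proof.
move=> fg fx phi Aphi phix.
have [V [oV Vx VU fk]] := fx phi Aphi phix.
exists (V `&` [set y | f y = g y]°); split => //.
- by apply: openI => //; exact: open_interior.
- by move=> y [/VU].
move=> k kr; apply: Ck_ext (CkS _ (fk k kr)).
  by move=> _ /set_mem [y [/VU Uy /interior_subset fgy] <-] /=;
    rewrite chart_mapK.
by move=> _ [y [Vy _] <-]; exists y.
Qed.

Lemma Cr_at_cont (F : tvsType R) (f : M -> F) x : Cr_at f x ->
  exists V, [/\ open V, V x & cont_on V f].
Proof.
have [_ /(_ x)[phi Aphi phix] _ _] := hA.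
move=> /(_ phi Aphi phix)[V [oV Vx VU fk]]; exists V; split => //.
have f0 : Ck 0 (phi @` V) (f \o chart_inv phi) by apply: fk; case: (r).
apply: (@cont_on_ext _ _ _ ((f \o chart_inv phi) \o phi)).
  by move=> y /set_mem Vy /=; rewrite chart_mapK //; exact: VU.
apply: (cont_on_comp (D' := phi @` V)) (Ck_cont f0).
  by move=> y Vy; exists y.
by apply: cont_onS VU _; apply/cont_onP; exact: chart_map_continuous.
Qed.

Lemma Cr_at_continuous (F : tvsType R) (f : M -> F) x : Cr_at f x ->
  {for x, continuous f}.
Proof. by move=> /Cr_at_cont[V [oV Vx cf]]; exact: (cont_on_open oV Vx). Qed.

Lemma Cr_at_cst (F : tvsType R) (c : F) x : Cr_at (fun=> c) x.
Proof.
move=> phi Aphi phix; exists (chart_dom phi); split => //.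
  exact: chart_dom_open.
by move=> k kr; exact: Ck_cst.
Qed.

Lemma Cr_at_pair (F1 F2 : tvsType R) (f : M -> F1) (g : M -> F2) x :
  Cr_at f x -> Cr_at g x -> Cr_at (fun y => (f y, g y)) x.
Proof.
move=> fx gx phi Aphi phix.
have [V [oV Vx VU fk]] := fx phi Aphi phix.
have [W [oW Wx WU gk]] := gx phi Aphi phix.
exists (V `&` W); split => //; [exact: openI|by move=> y [/VU]|].
move=> k kr; apply: Ck_pair.
  by apply: CkS (fk k kr) => _ [y [Vy _] <-]; exists y.
by apply: CkS (gk k kr) => _ [y [_ Wy] <-]; exists y.
Qed.

Lemma Cr_at_comp (F F' : tvsType R) (f : M -> F) (g : F -> F') (W : set F) x :
  open W -> W (f x) -> Ckr r W g -> Cr_at f x -> Cr_at (g \o f) x.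
Proof.
move=> oW Wfx gk fx phi Aphi phix.
have [V1 [oV1 V1x cf]] := Cr_at_cont fx.
have [V2 [oV2 V2x V2U fk]] := fx phi Aphi phix.
have oV : open (V1 `&` f @^-1` W) by exact: open_setI_preim.
exists (V2 `&` (V1 `&` f @^-1` W)); split => //; first exact: openI.
  by move=> y [/V2U].
move=> k kr; apply: (Ck_comp (f := f \o chart_inv phi) (D' := W)) (gk k kr).
- by move=> _ [y [/V2U phiy [_ Wfy]] <-] /=; rewrite chart_mapK.
- move=> z /interior_subset [y [/V2U phiy [_ Wfy]] <-] /=.
  by rewrite chart_mapK // (interior_id W).1.
- by apply: CkS (fk k kr) => _ [y [Vy _] <-]; exists y.
Qed.

Lemma Cr_at_add (F : tvsType R) (f g : M -> F) x :
  Cr_at f x -> Cr_at g x -> Cr_at (fun y => f y + g y) x.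
Proof.
move=> fx gx; have h := Cr_at_pair fx gx.
apply: (@Cr_at_comp _ _ _ (fun p => p.1 + p.2) setT) h => //;
  first exact: openT.
by move=> k _; apply: Ck_add; [exact: Ck_fst|exact: Ck_snd].
Qed.

Lemma Cr_at_scale (F : tvsType R) (f : M -> R^o) (g : M -> F) x :
  Cr_at f x -> Cr_at g x -> Cr_at (fun y => f y *: g y) x.
Proof.
move=> fx gx; have h := Cr_at_pair fx gx.
apply: (@Cr_at_comp _ _ _ (fun p : R^o * F => p.1 *: p.2) setT) h => //.
  exact: openT.
by move=> k _; exact: Ck_scale_fun.
Qed.

End Smooth.

Section Cutoff.
Context {R : realType}.

Lemma smooth_bump_vanishing (E : tvsType R) (y0 z0 : E) : hausdorff_space E ->
  z0 != y0 -> exists2 q : E -> R^o, (forall k, Ck k setT q) &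
  [/\ forall y, 0 <= q y <= 1, \forall y \near y0, q y = 1 &
    \forall y \near z0, q y = 0].
Proof.
move=> hE zy0.
have [|l [lc ll lz]] := @tvs_separates_points _ _ (z0 - y0) hE.
  by rewrite subr_eq0.
(* An affine function with values -1 at [y0] and 2 at [z0], strictly outside the interval [[0, 1]]
   on which [smooth_step] varies, so that the composition is constant near both points. *)
pose a (y : E) : R^o := (3 / l (z0 - y0)) *: l (y - y0) - 1.
have l0 : l 0 = 0.
  have := ll 1 0 0; rewrite scaler0 addr0 scale1r => h.
  by apply: (addrI (l 0)); rewrite addr0 -h.
have lk k : Ck k setT l by exact: Ck_linear.
have ak k : Ck k setT a.
  apply: (Ck_add (g := fun=> - 1 : R^o)); last exact: Ck_cst.
  apply: Ck_scale; first exact: Ck_cst.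
  apply: (Ck_compT (f := fun y => y - y0)) (lk k).
  apply: (Ck_add (f := id) (g := fun=> - y0)); last exact: Ck_cst.
  by apply: Ck_linear => // y; exact: cvg_id.
have ca : continuous a by apply: cont_onT; exact: (Ck_cont (ak 0)).
have ay0 : a y0 = -1 by rewrite /a subrr l0 scaler0 sub0r.
have az0 : a z0 = 2.
  by rewrite /a /GRing.scale /= -mulrA mulVf // mulr1; lra.
exists (@smooth_step R \o a).
  by move=> k; apply: Ck_compT (ak k) (smooth_step_Ck k).
split=> [y||]; first by rewrite smooth_step_ge0 smooth_step_le1.
- have n : nbhs (a y0 : R) [set u : R | u < 0].
    by apply: lt_nbhsl; rewrite ay0; lra.
  have h : nbhs y0 (a @^-1` [set u : R | u < 0]) by exact: ca y0 _ n.
  by apply: filterS h => y /= ay; apply: smooth_step1; exact: ltW.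
- have n : nbhs (a z0 : R) [set u : R | 1 < u].
    by apply: lt_nbhsr; rewrite az0; lra.
  have h : nbhs z0 (a @^-1` [set u : R | 1 < u]) by exact: ca z0 _ n.
  by apply: filterS h => y /= ay; apply: smooth_step0; exact: ltW.
Qed.

Context {M : topologicalType} (hM : hausdorff_space M).
Hypothesis hlc : locally_compact [set: M].
Variables (r : option nat) (A : rough_chart R M -> Prop).
Hypothesis hA : is_rough_manifold r A.

(** For each point of the compact set [C \ C°] there is a smooth function on the model space that is
    1 near [phi x0] and 0 near the image of that point. A product of finitely many vanishes near all
    of [C \ C°], so setting it to 0 outside [C°] leaves it C^r. *)
Lemma Cr_cutoff (x0 : M) (N : set M) : nbhs x0 N ->
  exists C, exists2 t : M -> R^o, forall x, Cr_at r A t x &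
    [/\ compact C, C `<=` N, forall x, 0 <= t x <= 1,
      \forall x \near x0, t x = 1 & forall x, ~ C x -> t x = 0].
Proof.
move=> Nx0; have [_ /(_ x0)[phi Aphi phix0] _ _] := hA.
have oU := @chart_dom_open _ _ _ phi.
have nU : nbhs x0 (chart_dom phi) by apply: open_nbhs_nbhs.
have [C [cC clC Cx0 CNU]] := compact_nbhs hM hlc (filterI Nx0 nU).
have CU : C `<=` chart_dom phi by move=> x /CNU[].
have cphi : cont_on (chart_dom phi) phi.
  by apply/cont_onP; exact: chart_map_continuous.
have phi_cont x : chart_dom phi x -> {for x, continuous phi}.
  by move=> Ux; exact: cont_on_open oU Ux cphi.
pose P (D : set M) := exists2 q : rough_model phi -> R^o,
  (forall k, Ck k setT q) &
  [/\ forall y, 0 <= q y <= 1, \forall y \near phi x0, q y = 1 &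
    forall z, D z -> \forall y \near phi z, q y = 0].
have [||||z [Cz nCz]|q qk [q01 q1 q0]] := @compact_ind M P (C `\` C°).
- exists (fun=> 1); first by move=> k; exact: Ck_cst.
  by split=> [_||//]; [rewrite ler01 lexx|exact: filterE].
- by move=> D1 D2 D12 [q qk [? ? q0]]; exists q => //; split => // z /D12 /q0.
- move=> D1 D2 [q qk [q01 q1 q0]] [s sk [s01 s1 s0]].
  exists (fun y => q y *: s y); first by move=> k; exact: Ck_scale.
  split=> [y||z [D1z|D2z]].
  + have [[/andP[a b]] /andP[c d]] := (q01 y, s01 y).
    by rewrite mulr_ge0 //= mulr_ile1.
  + near=> y; have -> : q y = 1 by near: y.
    by rewrite scale1r; near: y.
  + near=> y; have -> : q y = 0 by near: y; exact: q0.
    by rewrite scale0r.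
  + near=> y; have -> : s y = 0 by near: y; exact: s0.
    by rewrite scaler0.
- apply: (subclosed_compact _ cC); last by move=> z [].
  by rewrite setDE; apply: closedI => //; exact: open_closedC (open_interior _).
- have zx0 : phi z != phi x0.
    apply/eqP => /(congr1 (chart_inv phi)); rewrite !chart_mapK //;
      last exact: CU.
    by move=> zx; apply: nCz; rewrite zx; exact: Cx0.
  have [q qk [q01 q1 q0]] :=
    smooth_bump_vanishing (@rough_model_hausdorff _ _ phi) zx0.
  exists (phi @^-1` [set y | \forall u \near y, q u = 0]).
    apply: phi_cont; first exact: CU.
    exact: nbhs_interior q0.
  by exists q.
pose t x : R^o := if `[< C° x >] then q (phi x) else 0.
have tin x : C° x -> t x = q (phi x) by move=> Cx; rewrite /t asboolT.
have tnear x : ~ C° x -> \forall y \near x, t y = 0.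
  move=> nCx; have [Cx|nC] := pselect (C x).
    have h := phi_cont x (CU _ Cx) _ (q0 x (conj Cx nCx)).
    near=> y; rewrite /t; case: asboolP => // Cy.
    by near: y; exact: h.
  have h : nbhs x (~` C) by apply: open_nbhs_nbhs; split => //;
    exact: closed_openC.
  apply: filterS h => y nCy; rewrite /t asboolF // => /interior_subset.
  exact: nCy.
exists C, t; last split => //.
- move=> x; have [Cx|nCx] := pselect (C° x); last first.
    have h0 := @Cr_at_cst R M r A R^o 0 x.
    apply: Cr_at_near h0; apply: filterS (tnear x nCx) => y ->.
    by [].
  apply: (@Cr_at_near _ _ _ _ _ (q \o phi)).
    have : nbhs x C° by apply: nbhs_interior.
    by apply: filterS => y Cy; rewrite tin.
  apply: (Cr_at_comp hA (W := setT)) => //; first exact: openT.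
  apply: Cr_at_chart => //; apply: CU; exact: interior_subset.
- by move=> x /CNU[].
- by move=> x; rewrite /t; case: asboolP => _ //; rewrite lexx ler01.
- have h : nbhs x0 C° by exact: nbhs_interior.
  apply: filterS (filterI h (phi_cont x0 phix0 _ q1)) => y [Cy qy].
  by rewrite tin.
- by move=> x nCx; rewrite /t asboolF // => /interior_subset.
Unshelve. all: by end_near. Qed.

End Cutoff.

(** * Approximation of group-valued maps *)

Section LieGroup.
Context {R : realType} {F : tvsType R} {G : topGroupType} (B : chart G F ->
  Prop).
Hypothesis hF : hausdorff_space F.
Hypothesis hG : is_lie_group B.

Lemma lie_mulg_cvg (T : Type) (H : set_system T) {FH : Filter H}
    (f g : T -> G) (a b : G) :
  f @ H --> a -> g @ H --> b -> (fun i => (f i * g i)%g) @ H --> (a * b)%g.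
Proof.
have [_ _ [mc _] _] := hG.
by move=> fa gb; apply: (cvg_comp2 fa gb); exact: (mc (a, b)).
Qed.

Lemma lie_invg_cvg (T : Type) (H : set_system T) {FH : Filter H}
    (f : T -> G) (a : G) : f @ H --> a ->
      (fun i => (f i)^-1%g) @ H --> (a^-1)%g.
Proof.
have [_ _ _ [ic _]] := hG.
by move=> fa; exact: (cvg_comp f _ fa (ic a)).
Qed.

Lemma lie_nbhs1_mul (U : set G) : nbhs (1%g : G) U ->
  exists2 V, nbhs (1%g : G) V & forall a b, V a -> V b -> U (a * b)%g.
Proof.
move=> U1.
have h : (fun p : G * G => (p.1 * p.2)%g) @ nbhs (1%g : G,
  1%g : G) --> (1 * 1)%g.
  by apply: lie_mulg_cvg; [exact: cvg_fst|exact: cvg_snd].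
rewrite mulg1 in h; have [[V W] /= [V1 W1] VW] := h _ U1.
exists (V `&` W); first exact: filterI.
by move=> a b [Va _] [_ Wb]; exact: (VW (a, b)).
Qed.

Lemma lie_nbhs1_div (U : set G) : nbhs (1%g : G) U ->
  exists2 V, nbhs (1%g : G) V & forall a b, V a -> V b -> U (a^-1 * b)%g.
Proof.
move=> U1.
have h : (fun p : G * G => (p.1^-1 * p.2)%g) @ nbhs (1%g : G,
  1%g : G) --> (1^-1 * 1)%g.
  by apply: lie_mulg_cvg; [apply: lie_invg_cvg; exact: cvg_fst|exact: cvg_snd].
rewrite mulVg in h; have [[V W] /= [V1 W1] VW] := h _ U1.
exists (V `&` W); first exact: filterI.
by move=> a b [Va _] [_ Wb]; exact: (VW (a, b)).
Qed.

Lemma lie_chart_open psi (V : set G) : B psi -> open V ->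
  V `<=` chart_dom psi -> open (psi @` V).
Proof.
move=> Bpsi oV VU; have [W oW ->] := chart_image_open oV VU.
by apply: openI => //; have [_ [h _ _ _] _ _] := hG; exact: h.
Qed.

Lemma lie_codom_open psi : B psi -> open (chart_codom psi).
Proof. by move=> Bpsi; apply: lie_chart_open => //; exact: chart_dom_open. Qed.

Lemma chart_continuous (X : topologicalType) (E : tvsType R) (psi : chart X E)
  x :
  chart_dom psi x -> {for x, continuous psi}.
Proof.
move=> Ux; apply: (cont_on_open (@chart_dom_open _ _ _ psi) Ux).
by apply/cont_onP; exact: chart_map_continuous.
Qed.

Lemma chart_inv_cont psi v : B psi -> chart_codom psi v ->
  {for v, continuous (chart_inv psi)}.
Proof.
move=> Bpsi Uv; apply: (cont_on_open (lie_codom_open Bpsi) Uv).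
by apply/cont_onP; exact: chart_inv_continuous.
Qed.

Lemma chart_invK (X : topologicalType) (E : tvsType R) (psi : chart X E) v :
  chart_codom psi v -> chart_dom psi (chart_inv psi v) /\ psi (chart_inv psi
    v) = v.
Proof. by move=> [x Ux <-]; rewrite !chart_mapK. Qed.

(** Turns additive closeness in the chart into closeness in [G], uniformly for [y] near [y0]:
    [y^-1 * chart_inv psi v] is continuous at [(y0, psi y0)], with value 1 there. *)
Lemma chart_inv_unif_near psi (y0 : G) (V : set G) : B psi ->
  chart_dom psi y0 -> nbhs (1%g : G) V ->
  exists N, exists2 Q, nbhs (0 : F) Q & nbhs y0 N /\
    forall y v, N y -> chart_codom psi v -> Q (v - psi y) ->
      V (y^-1 * chart_inv psi v)%g.
Proof.
move=> Bpsi Uy0 V1.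
have h : (fun p : G * F => (p.1^-1 * chart_inv psi p.2)%g) @ nbhs (y0, psi y0)
    --> (y0^-1 * y0)%g.
  apply: lie_mulg_cvg; first by apply: lie_invg_cvg; exact: cvg_fst.
  have c : chart_inv psi @ nbhs (psi y0) --> y0.
    rewrite -[X in _ --> X](chart_mapK Uy0).
    by apply: (chart_inv_cont Bpsi); exists y0.
  exact: (cvg_comp _ _ (@cvg_snd _ _ _ _ _) c).
rewrite mulVg in h; have [[N W] /= [Ny W0] NW] := h _ V1.
have : (fun p : F * F => p.1 + p.2) @ nbhs (psi y0, 0 : F) --> psi y0 + 0.
  exact: (@add_continuous F (psi y0, 0)).
rewrite addr0 => /(_ _ W0)[[W1 Q] /= [W10 Q0] W1Q].
exists (N `&` psi @^-1` W1), Q => //; split.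
  by apply: filterI => //; apply: chart_continuous.
move=> y v [Ny' W1y] _ Qv; apply: (NW (y, v)); split => //=.
have := W1Q (psi y, v - psi y) (conj W1y Qv).
by rewrite /= addrC subrK.
Qed.

Lemma chart_inv_unif (X : topologicalType) psi (h : X ->
  G) (C : set X) (V : set G) :
  B psi -> continuous h -> compact C -> (forall x, C x ->
    chart_dom psi (h x)) ->
  nbhs (1%g : G) V ->
  exists2 Q, nbhs (0 : F) Q & forall x v, C x -> chart_codom psi v ->
    Q (v - psi (h x)) -> V ((h x)^-1 * chart_inv psi v)%g.
Proof.
move=> Bpsi ch cC hC V1.
pose P (D : set X) := exists2 Q, nbhs (0 : F) Q & forall x v, D x ->
  chart_codom psi v -> Q (v - psi (h x)) -> V ((h x)^-1 * chart_inv psi v)%g.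
apply: (@compact_ind X P) => //.
- by exists setT => //; exact: filterT.
- by move=> D1 D2 D12 [Q Q0 QV]; exists Q => // x v /D12; exact: QV.
- move=> D1 D2 [Q1 Q10 Q1V] [Q2 Q20 Q2V]; exists (Q1 `&` Q2);
  first exact: filterI.
  by move=> x v [D1x|D2x] cv [q1 q2]; [exact: Q1V|exact: Q2V].
- move=> x /hC hx; have [N [Q Q0 [Nx NV]]] := chart_inv_unif_near Bpsi hx V1.
  exists (h @^-1` N); first exact: ch.
  by exists Q => // y v Ny; exact: NV.
Qed.

End LieGroup.

Section Approx.
Context {R : realType} {F : tvsType R} {G : topGroupType} (B : chart G F ->
  Prop).
Hypothesis hF : hausdorff_space F.
Hypothesis hG : is_lie_group B.
Context {M : topologicalType} (hM : hausdorff_space M).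
Hypothesis hlc : locally_compact [set: M].
Variables (r : option nat) (A : rough_chart R M -> Prop).

Definition Cr_group_at (h : M -> G) (x : M) :=
  exists psi, [/\ B psi, chart_dom psi (h x) & Cr_at r A (psi \o h) x].

Hypothesis hA : is_rough_manifold r A.

Lemma Cr_group_at_chart (h : M -> G) x psi : continuous h -> Cr_group_at h x ->
  B psi -> chart_dom psi (h x) -> Cr_at r A (psi \o h) x.
Proof.
move=> ch [phi [Bphi phix hx]] Bpsi psix.
pose D := chart_dom phi `&` chart_dom psi.
have oD : open D by apply: openI; exact: chart_dom_open.
have Dhx : D (h x) by [].
have DU : D `<=` chart_dom phi by move=> y [].
have [_ [_ _ /(_ phi psi Bphi Bpsi)[tk _] _] _ _] := hG.
have near_D : \forall y \near x, D (h y).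
  by apply: (ch x); exact: open_nbhs_nbhs.
apply: (@Cr_at_near _ _ _ _ _ ((psi \o chart_inv phi) \o (phi \o h))).
  by apply: filterS near_D => y [phiy _] /=; rewrite chart_mapK.
apply: (Cr_at_comp hA (lie_chart_open hG Bphi oD DU)) hx; first by exists (h x).
by move=> k _; exact: ((Cr_onP None _ _ hF).1 tk).
Qed.

Lemma Cr_group_at_near (h h' : M -> G) x :
  (\forall y \near x, h y = h' y) -> Cr_group_at h x -> Cr_group_at h' x.
Proof.
move=> hh [psi [Bpsi psix hx]]; exists psi; split => //.
  by rewrite -(nbhs_singleton hh).
by apply: Cr_at_near hx; apply: filterS hh => y /= ->.
Qed.

(** [Cr_map] asks for derivatives on a whole chart image; as this image is regular, [Ck_local] glues
    the local ones. *)
Lemma Cr_group_at_map (h : M -> G) : continuous h ->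
  (forall x, Cr_group_at h x) -> Cr_map r A B h.
Proof.
move=> ch hk; split => // _ phi psi Aphi Bpsi.
pose V := chart_dom phi `&` h @^-1` chart_dom psi.
have oV : open V.
  apply: openI; first exact: chart_dom_open.
  by move/continuousP: ch; apply; exact: chart_dom_open.
have VU : V `<=` chart_dom phi by move=> y [].
apply/Cr_onP => // k kr; apply: Ck_local => //.
  exact: chart_image_regular.
move=> _ [x [phix psix] <-].
have [W [oW Wx WU fk]] := Cr_group_at_chart ch (hk x) Bpsi psix Aphi phix.
have [W' oW' WE] := chart_image_open oW WU.
exists W'; split => //.
  have : (phi @` W) (phi x) by exists x.
  by rewrite WE => -[].
apply: CkS (fk k kr); rewrite WE => _ [[y Vy <-] W'y]; split => //.
by exists y => //; exact: VU.
Qed.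

(* The new map [k'] interpolates convexly, in the chart, between [k] and the
   constant [h x1]; it is thus constant where the cutoff is 1, as smooth as [k]
   elsewhere, and does not move further away from [h]. *)
Lemma Cr_local_step (psi : chart G F) (C : set M) (h : M -> G) (Q : set F) x1 :
  B psi -> continuous h -> cvx Q -> open Q -> Q 0 ->
  (forall x, C x -> chart_dom psi (h x)) ->
  (forall x v, C x -> Q (v - psi (h x)) -> chart_codom psi v) ->
  C° x1 ->
  exists2 D, nbhs x1 D & forall k : M -> G, continuous k ->
    (forall x, C x -> chart_dom psi (k x) /\ Q (psi (k x) - psi (h x))) ->
    exists k' : M -> G, [/\ continuous k',
      (forall x, C x -> chart_dom psi (k' x) /\ Q (psi (k' x) - psi (h x))),
      (forall x, ~ C x -> k' x = k x),
      (forall x, Cr_group_at k x -> Cr_group_at k' x) &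
      (forall x, D x -> Cr_group_at k' x)].
Proof.
move=> Bpsi ch cQ oQ Q0 hC hQ Cx1.
have hx1 := hC _ (interior_subset Cx1).
have psih_cont : {for x1, continuous (psi \o h)}.
  by apply: continuous_comp; [exact: ch|exact: chart_continuous].
pose c1 := psi (h x1).
(* The cutoff will be supported where the constant [c1] is itself [Q]-close to [psi h]. *)
have N1 : nbhs x1 (C° `&` [set x | Q (c1 - psi (h x))]).
  apply: filterI; first exact: nbhs_interior.
  have cv : (fun x => c1 - psi (h x)) @ x1 --> c1 - c1.
    by apply: tvs_cvgB; [exact: cvg_cst|exact: psih_cont].
  by apply: cv; rewrite subrr; exact: open_nbhs_nbhs.
have [C1 [t tk [cC1 C1N t01 t1 t0]]] := Cr_cutoff hM hlc hA N1.
(* [t] has to be 1 near [x] and not only at [x], since being C^r at [x] concerns a neighbourhood. *)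
exists [set x | \forall y \near x, t y = 1]; first exact: nbhs_interior t1.
move=> k ck kC.
pose v x := psi (k x) + t x *: (c1 - psi (k x)).
have vQ x : C x -> Q (v x - psi (h x)).
  move=> Cx; have [_ Qk] := kC x Cx.
  have [C1x|nC1x] := pselect (C1 x); last by rewrite /v t0 // scale0r addr0.
  have [_ Qc] := C1N x C1x; have /andP[tx0 tx1] := t01 x.
  (* [v x - psi (h x)] is the convex combination, with weight [t x], of [c1 - psi (h x)] and
     [psi (k x) - psi (h x)]. *)
  have := cQ _ _ _ Qc Qk tx0 tx1; congr Q.
  have -> : v x - psi (h x) = psi (k x) - psi (h x) + t x *: (c1 - psi (k x)).
    by rewrite /v addrAC.
  rewrite scalerBl scale1r addrCA -scalerBr; congr (_ + _ *: _).
  by rewrite opprB addrA subrK.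
have vE x : ~ C1 x -> v x = psi (k x) by move=> ?;
  rewrite /v t0 // scale0r addr0.
have vcod x : C x -> chart_codom psi (v x) by move=> Cx; apply: (hQ x) => //;
  exact: vQ.
(* [C°] is open and contains [C1], off which [t] is 0; so [k'] is given by the chart formula near
   every point of [C1] and equals [k] near every other point. *)
pose k' x := if `[< C° x >] then chart_inv psi (v x) else k x.
have k'in x : C° x -> k' x = chart_inv psi (v x) by move=> Cx;
  rewrite /k' asboolT.
have k'out x : ~ C1 x -> k' x = k x.
  move=> nC1; rewrite /k'; case: asboolP => // Cx; rewrite vE // chart_mapK //.
  by have [] := kC x (interior_subset Cx).
have psik' x : C° x -> chart_dom psi (k' x) /\ psi (k' x) = v x.
  by move=> Cx; rewrite k'in //; apply: chart_invK; apply: vcod;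
    exact: interior_subset.
have C1C x : C1 x -> C° x by move=> /C1N[].
have near_out x : ~ C1 x -> \forall y \near x, k y = k' y.
  move=> nC1; have : nbhs x (~` C1).
    apply: open_nbhs_nbhs; split => //; apply: closed_openC.
    exact: compact_closed.
  by apply: filterS => y nC1y; rewrite k'out.
have near_in x : C° x -> \forall y \near x, v y = psi (k' y).
  move=> Cx; have : nbhs x C° by exact: nbhs_interior.
  by apply: filterS => y Cy; rewrite (psik' y Cy).2.
exists k'; split.
- move=> x; have [Cx|nCx] := pselect (C° x); last first.
    have nC1 : ~ C1 x by move=> /C1C.
    rewrite /continuous_at -(nbhs_singleton (near_out x nC1)).
    by apply: cvg_trans (ck x); apply: near_eq_cvg; exact: near_out.
  have [kx _] := kC x (interior_subset Cx).
  have cpk : (psi \o k) @ x --> psi (k x).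
    by apply: continuous_comp; [exact: ck|exact: chart_continuous].
  have cv : v @ x --> v x.
    apply: tvs_cvgD; first exact: cpk.
    apply: tvs_cvgZ; first exact: (Cr_at_continuous hA (tk x)).
    by apply: tvs_cvgB; [exact: cvg_cst|exact: cpk].
  have ci := chart_inv_cont hG Bpsi (vcod x (interior_subset Cx)).
  have cc : (fun y => chart_inv psi (v y)) @ x --> k' x.
    by rewrite k'in //; exact: (cvg_comp _ _ cv ci).
  apply: cvg_trans cc; apply: near_eq_cvg.
  have : nbhs x C° by exact: nbhs_interior.
  by apply: filterS => y Cy; rewrite k'in.
- move=> x Cx; have [C1x|nC1x] := pselect (C1 x); last by rewrite k'out //;
  exact: kC.
  have [d e] := psik' x (C1C x C1x); split => //.
  by rewrite e; exact: vQ.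
- by move=> x nCx; apply: k'out => /C1C /interior_subset.
- move=> x kx; have [C1x|nC1x] := pselect (C1 x); last first.
    exact: Cr_group_at_near (near_out x nC1x) kx.
  have Cx := C1C x C1x; have [d e] := psik' x Cx.
  have [kdx _] := kC x (interior_subset Cx).
  have kk := Cr_group_at_chart ck kx Bpsi kdx.
  exists psi; split => //; apply: Cr_at_near (near_in x Cx) _.
  apply: (Cr_at_add hA kk (g := fun y => t y *: (c1 - psi (k y)))).
  apply: (Cr_at_scale hA (tk x) (g := fun y => c1 - psi (k y))).
  have -> : (fun y => c1 - psi (k y)) = (fun y => c1 + (fun v => -1 *: v)
    ((psi \o k) y)).
    by apply/funext => y; rewrite scaleN1r.
  apply: (Cr_at_add hA (f := fun=> c1)); first exact: Cr_at_cst.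
  apply: (@Cr_at_comp _ _ _ _ hA _ _ _ (fun v => -1 *: v) setT _ openT I _ kk).
  move=> n _; apply: Ck_scale; first exact: Ck_cst.
  by apply: Ck_linear => // y; exact: cvg_id.
- move=> x /= tx; have C1x : C1 x.
    by apply: contrapT => /t0; rewrite (nbhs_singleton tx) => /eqP;
      rewrite oner_eq0.
  have Cx := C1C x C1x; have [d e] := psik' x Cx.
  exists psi; split => //; apply: (@Cr_at_near _ _ _ _ _ (fun=> c1));
    last exact: Cr_at_cst.
  apply: filterS (filterI tx (near_in x Cx)) => y [ty ve] /=.
  by rewrite -ve /v ty scale1r addrC subrK.
Qed.

(* Quantifying over all maps [h'] close to [h] makes the property stable under
   finite unions. *)
Definition smoothable (h : M -> G) (L D : set M) :=
  exists2 V0, nbhs (1%g : G) V0 & forall h' : M -> G, continuous h' ->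
    (forall x, V0 ((h x)^-1 * h' x)%g) -> forall V, nbhs (1%g : G) V ->
    exists k : M -> G, [/\ continuous k, forall x, V ((h' x)^-1 * k x)%g,
      forall x, ~ L x -> k x = h' x,
      forall x, Cr_group_at h' x -> Cr_group_at k x &
      forall x, D x -> Cr_group_at k x].

(** Near [x0] all maps close to [h] have values in one chart [psi], which determines [V0]. Inside
    that chart the steps of [Cr_local_step] preserve one and the same [Q], so covering [D] costs
    nothing in closeness. *)
Lemma smoothable_nbhs (h : M -> G) (L : set M) x0 : continuous h -> L° x0 ->
  exists2 D, nbhs x0 D & smoothable h L D.
Proof.
move=> ch Lx0; have [_ [_ /(_ (h x0))[psi Bpsi psix0] _ _] _ _] := hG.
pose c0 := psi (h x0).
have oc := lie_codom_open hG Bpsi.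
(* [c0 + Q0 + Q0] stays in the codomain: one [Q0] for the distance of [h'] from [c0], one for that
   of the improved map from [h']. *)
have [Q0 [oQ0 Q00 Q0c cQ0]] : exists Q0 : set F, [/\ open Q0, Q0 0,
    (forall a b, Q0 a -> Q0 b -> chart_codom psi (c0 + (a + b))) & cvx Q0].
  have h1 : (fun p : F * F => c0 + (p.1 + p.2)) @ nbhs (0 : F,
    0 : F) --> c0 + (0 + 0).
    apply: tvs_cvgD; first exact: cvg_cst.
    by apply: tvs_cvgD; [exact: cvg_fst|exact: cvg_snd].
  have n0 : nbhs (c0 + (0 + 0)) (chart_codom psi).
    by rewrite !addr0; apply: open_nbhs_nbhs; split => //; exists (h x0).
  have [[U W] /= [U0 W0] UW] := h1 _ n0.
  have [Q0 [oQ0 Q00 Q0U cQ0]] := cvx_nbhs (filterI U0 W0).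
  exists Q0; split => // a b /Q0U[Ua _] /Q0U[_ Wb].
  exact: (UW (a, b)).
pose W := chart_dom psi `&` [set g | Q0 (psi g - c0)].
have nW : nbhs (h x0) W.
  apply: filterI; first by apply: open_nbhs_nbhs; split => //;
    exact: chart_dom_open.
  have cv : (fun g => psi g - c0) @ h x0 --> c0 - c0.
    by apply: tvs_cvgB; [exact: chart_continuous|exact: cvg_cst].
  by apply: cv; rewrite subrr; exact: open_nbhs_nbhs.
have cm : (fun p : M * G => (h p.1 * p.2)%g) @ nbhs (x0,
  1%g : G) --> (h x0 * 1)%g.
  apply: (lie_mulg_cvg hG); last exact: cvg_snd.
  have c : h @ nbhs x0 --> h x0 by exact: ch.
  exact: (cvg_comp _ _ (@cvg_fst _ _ _ _ _) c).
rewrite mulg1 in cm; have [[N V0] /= [Nx0 V01] NV0] := cm _ nW.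
have [C [cC clC Cx0 CNL]] := compact_nbhs hM hlc (filterI Nx0 Lx0).
have nC : nbhs x0 C° by exact: nbhs_interior.
have [D [cD _ Dx0 DC]] := compact_nbhs hM hlc nC.
exists D => //; exists V0 => // h' ch' hh' V V1.
have h'W x : C x -> W (h' x).
  move=> /CNL[Nx _]; have := NV0 (x, ((h x)^-1 * h' x)%g) (conj Nx (hh' x)).
  by rewrite /= mulgA mulgV mul1g.
have h'C x : C x -> chart_dom psi (h' x) by move=> /h'W[].
have [Q1 Q10 Q1V] := chart_inv_unif hG Bpsi ch' cC h'C V1.
have nQ0 : nbhs (0 : F) Q0 by exact: open_nbhs_nbhs.
have [Q [oQ Q0' QQ cQ]] := cvx_nbhs (filterI nQ0 Q10).
have hQ x v : C x -> Q (v - psi (h' x)) -> chart_codom psi v.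
  move=> /h'W[_ a] /QQ[b _]; have := Q0c _ _ a b; congr (chart_codom _ _).
  by rewrite addrA [c0 + _]addrC subrK addrC subrK.
pose close k := forall x, C x ->
  chart_dom psi (k x) /\ Q (psi (k x) - psi (h' x)).
pose P (D' : set M) := forall k : M -> G, continuous k -> close k ->
  exists k' : M -> G, [/\ continuous k', close k',
    (forall x, ~ C x -> k' x = k x),
    (forall x, Cr_group_at k x -> Cr_group_at k' x) &
    (forall x, D' x -> Cr_group_at k' x)].
have PD : P D.
  apply: compact_ind cD _ => //.
  - by move=> k ck kC; exists k; split.
  - move=> D1 D2 D12 PD2 k ck kC; have [k' [? ? ? ? kD]] := PD2 k ck kC.
    by exists k'; split => // x /D12; exact: kD.
  - move=> D1 D2 P1 P2 k ck kC.
    have [k1 [ck1 k1C k1o k1s k1D]] := P1 k ck kC.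
    have [k2 [ck2 k2C k2o k2s k2D]] := P2 k1 ck1 k1C.
    exists k2; split => //.
    + by move=> x nC'; rewrite k2o // k1o.
    + by move=> x /k1s /k2s.
    + by move=> x [/k1D /k2s|/k2D].
  - move=> x Dx; exact: (Cr_local_step Bpsi ch' cQ oQ Q0' h'C hQ (DC _ Dx)).
have [|k [ck kC ko ks kD]] := PD h' ch'.
  by move=> x Cx; split; [exact: h'C|rewrite subrr].
exists k; split => //.
- move=> x; have [Cx|nCx] := pselect (C x); last first.
    by rewrite ko // mulVg; exact: nbhs_singleton.
  have [kd /QQ[_ kQ]] := kC x Cx.
  have := Q1V x (psi (k x)) Cx _ kQ; rewrite chart_mapK //; apply.
  by exists (k x).
- by move=> x nL; apply: ko => /CNL[].
Qed.

(** Improvements in different charts are composed, and each moves the map. For a union, the first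
    must leave it within reach [V2] of the second, whence [V3 * V3] in [V2], and both together must
    stay in [V], whence [V4 * V4] in [V]. *)
Lemma smoothable_compact (h : M -> G) (K L : set M) : continuous h ->
  compact K -> K `<=` L° -> smoothable h L K.
Proof.
move=> ch cK KL; apply: compact_ind cK _ => //.
- exists setT; first exact: filterT.
  move=> h' ch' _ V V1; exists h'; split => // x.
  by rewrite mulVg; exact: nbhs_singleton.
- move=> D1 D2 D12 [V0 V01 H]; exists V0 => // h' ch' hh' V V1.
  have [k [? ? ? ? kD]] := H h' ch' hh' V V1.
  by exists k; split => // x /D12; exact: kD.
- move=> D1 D2 [V1 V11 H1] [V2 V21 H2].
  have [V3 V31 V3P] := lie_nbhs1_mul hG V21.
  exists (V1 `&` V3); first exact: filterI.
  move=> h' ch' hh' V nV; have [V4 V41 V4P] := lie_nbhs1_mul hG nV.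
  have [|k1 [ck1 k1V k1o k1s k1D]] := H1 h' ch' _ _ (filterI V31 V41).
    by move=> x; have [] := hh' x.
  have [|k2 [ck2 k2V k2o k2s k2D]] := H2 k1 ck1 _ _ V41.
    move=> x; have [_ a] := hh' x; have [b _] := k1V x.
    by have := V3P _ _ a b; rewrite -mulgA mulVKg.
  exists k2; split => //.
  + move=> x; have [_ a] := k1V x.
    by have := V4P _ _ a (k2V x); rewrite -mulgA mulVKg.
  + by move=> x nL; rewrite k2o // k1o.
  + by move=> x /k1s /k2s.
  + by move=> x [/k1D /k2s|/k2D].
- by move=> x /KL; exact: smoothable_nbhs.
Qed.

End Approx.

(** * Approximation with control of supports *)

Section Density.
Context {R : realType} {F : tvsType R} {G : topGroupType} (B : chart G F ->
  Prop).
Hypothesis hF : hausdorff_space F.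
Hypothesis hG : is_lie_group B.

Lemma lie_nbhs1_closure (U : set G) : nbhs (1%g : G) U ->
  exists2 V, nbhs (1%g : G) V & closure V `<=` U.
Proof.
move=> U1.
have h : (fun p : G * G => (p.1 * p.2^-1)%g) @ nbhs (1%g : G,
  1%g : G) --> (1 * 1^-1)%g.
  by apply: (lie_mulg_cvg hG); [exact: cvg_fst|apply: (lie_invg_cvg hG);
    exact: cvg_snd].
rewrite mulgV in h; have [[V W] /= [V1 W1] VW] := h _ U1.
exists (V `&` W); first exact: filterI.
move=> g clg.
have c : (fun x : G => (g^-1 * x)%g) @ g --> (g^-1 * g)%g.
  by apply: (lie_mulg_cvg hG); [exact: cvg_cst|exact: cvg_id].
rewrite mulVg in c; have [v [[Vv Wv] [Vw Ww]]] := clg _ (c _ (filterI V1 W1)).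
by have := VW (v, (g^-1 * v)%g) (conj Vv Ww); rewrite /= invgM invgK mulVKg.
Qed.

(* Pushing a neighbourhood of 1 into 1 turns maps vanishing at infinity into
   compactly supported ones. *)
Lemma lie_retraction (U : set G) : nbhs (1%g : G) U ->
  exists T : G -> G, [/\ continuous T, \forall g \near 1%g, T g = 1%g &
    forall g, U (g^-1 * T g)%g].
Proof.
move=> U1; have [_ [_ /(_ 1%g)[psi Bpsi psi1] _ _] _ _] := hG.
pose c := psi 1%g; have oU := @chart_dom_open _ _ _ psi.
have oc := lie_codom_open hG Bpsi.
have cc : chart_codom psi c by exists 1%g.
(* With the closure of [V] inside the chart domain, [T] is the identity near every point outside
   that domain, hence continuous there; [V2] bounds the displacement. *)
have [V V1 VU] := lie_nbhs1_closure (open_nbhs_nbhs (conj oU psi1)).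
have [V2 V21 V2U] := lie_nbhs1_div hG U1.
have ci : chart_inv psi @ nbhs c --> (1%g : G).
  by rewrite -[X in _ --> X](chart_mapK psi1);
    exact: (chart_inv_cont hG Bpsi cc).
have sh : (fun v => c + v) @ nbhs (0 : F) --> c + 0.
  by apply: tvs_cvgD; [exact: cvg_cst|exact: cvg_id].
rewrite addr0 in sh.
have nQ : nbhs (0 : F) [set v | chart_codom psi (c + v) /\
    (V `&` V2) (chart_inv psi (c + v))].
  apply: filterI; first by apply: sh; exact: open_nbhs_nbhs.
  by apply: (sh (chart_inv psi @^-1` (V `&` V2))); apply: ci; exact: filterI.
have [Q [oQ Q0 QQ cQ]] := cvx_nbhs nQ.
have nQ0 : nbhs (0 : F) Q by exact: open_nbhs_nbhs.
have [p [sp p1 p2]] := gauge_sublinear cQ nQ0.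
have cp : continuous (p : F -> R^o).
  apply: (sublinear_dominated_continuous sp nQ0 p1) => x y.
  by have [_ /(_ (x - y) y)] := sp; rewrite subrK; lra.
(* 0 where the gauge is at most 1/2, and 1 where it is at least 1, in particular off [Q]. *)
pose s (v : F) : R^o := 1 - smooth_step (2 * p v - 1).
have s01 v : 0 <= s v <= 1.
  have := @smooth_step_ge0 R (2 * p v - 1);
    have := @smooth_step_le1 R (2 * p v - 1).
  by rewrite /s; lra.
have s1 v : ~ Q v -> s v = 1.
  move=> /p2 h; rewrite /s smooth_step0 ?subr0 //; lra.
have cs : continuous s.
  have cst : continuous (@smooth_step R).
    by apply: cont_onT; exact: Ck_cont (smooth_step_Ck 0).
  move=> v.
  have h1 : (fun x => 2 * p x - 1 : R^o) @ v --> (2 * p v - 1 : R^o).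
    apply: tvs_cvgB; last exact: cvg_cst.
    by apply: tvs_cvgZ; [exact: cvg_cst|exact: cp].
  apply: (@tvs_cvgB _ R^o); first exact: cvg_cst.
  exact: (cvg_comp _ _ h1 (cst _)).
have s0 : \forall v \near (0 : F), s v = 0.
  have n : nbhs (p 0) [set t : R | t < 1 / 2].
    by apply: lt_nbhsl; rewrite sublinear0 //; lra.
  have h : nbhs (0 : F) (p @^-1` [set t : R | t < 1 / 2]) by exact: cp 0 _ n.
  apply: filterS h => v /= pv; rewrite /s smooth_step1 ?subrr //; lra.
pose tau v := c + s (v - c) *: (v - c).
have tauQ v : Q (v - c) -> Q (s (v - c) *: (v - c)).
  move=> Qv; have /andP[a b] := s01 (v - c).
  by have := cQ _ _ _ Qv Q0 a b; rewrite scaler0 addr0.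
have taun v : ~ Q (v - c) -> tau v = v.
  by move=> nQv; rewrite /tau s1 // scale1r addrC subrK.
have Qin v : Q (v - c) -> (V `&` V2) (chart_inv psi v).
  by move=> /QQ[_]; rewrite addrC subrK.
pose T g := if `[< chart_dom psi g /\ Q (psi g - c) >]
  then chart_inv psi (tau (psi g)) else g.
have TE g : chart_dom psi g -> T g = chart_inv psi (tau (psi g)).
  move=> Ug; rewrite /T; case: asboolP => // nQg.
  by rewrite taun ?chart_mapK // => Qg; apply: nQg.
have taucod g : chart_dom psi g -> chart_codom psi (tau (psi g)).
  move=> Ug; have [Qg|nQg] := pselect (Q (psi g - c)).
    by have [] := QQ _ (tauQ _ Qg).
  by rewrite taun //; exists g.
have nU g : chart_dom psi g -> nbhs g (chart_dom psi) by move=> Ug;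
  exact: open_nbhs_nbhs.
exists T; split.
- move=> g; have [Ug|nUg] := pselect (chart_dom psi g).
    have ctau : (fun x => tau (psi x)) @ g --> tau (psi g).
      have cpsi : (fun x => psi x - c) @ g --> psi g - c.
        by apply: tvs_cvgB; [exact: chart_continuous|exact: cvg_cst].
      apply: tvs_cvgD; first exact: cvg_cst.
      apply: tvs_cvgZ => //; exact: (cvg_comp _ _ cpsi (cs _)).
    have h : (fun x => chart_inv psi (tau (psi x))) @ g --> T g.
      rewrite TE //; apply: (cvg_comp _ _ ctau).
      exact: (chart_inv_cont hG Bpsi (taucod g Ug)).
    apply: cvg_trans h; apply: near_eq_cvg.
    by apply: filterS (nU g Ug) => x Ux; rewrite TE.
  have nV : nbhs g (~` closure V).
    apply: open_nbhs_nbhs; split; last by move=> /VU.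
    by apply: closed_openC; exact: closed_closure.
  have Tid x : ~ closure V x -> T x = x.
    move=> nVx; rewrite /T; case: asboolP => // -[Ux Qx]; exfalso; apply: nVx.
    by apply: subset_closure; have [] := Qin _ Qx; rewrite chart_mapK.
  rewrite /continuous_at Tid; last exact: nbhs_singleton nV.
  have h : (fun x => x) @ g --> g by exact: cvg_id.
  by apply: cvg_trans h; apply: near_eq_cvg; apply: filterS nV => x /Tid.
- have cpsi : (fun x => psi x - c) @ (1%g : G) --> c - c.
    by apply: tvs_cvgB; [exact: chart_continuous|exact: cvg_cst].
  rewrite subrr in cpsi.
  have h : \forall g \near (1%g : G), s (psi g - c) = 0 by exact: cpsi s0.
  apply: filterS (filterI (nU _ psi1) h) => g [Ug sg].
  by rewrite TE // /tau sg scale0r addr0 chart_mapK.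
- move=> g; rewrite /T; case: asboolP => [[Ug Qg]|_]; last first.
    by rewrite mulVg; exact: nbhs_singleton.
  apply: V2U; first by have [_] := Qin _ Qg; rewrite chart_mapK.
  by have [_ []] := QQ _ (tauQ _ Qg).
Qed.

Context {M : topologicalType} (hM : hausdorff_space M).
Hypothesis hlc : locally_compact [set: M].
Variables (r : option nat) (A : rough_chart R M -> Prop).
Hypothesis hA : r <> Some 0%N -> is_rough_manifold r A.

(** Off the closed set [K] the map [h] is locally 1, hence C^r, which the improvement preserves; on
    [K] the improvement makes it C^r. Off [L] nothing changes, which bounds the support. For
    [r = 0], [h] itself will do. *)
Lemma CrL_approx (K L : set M) (h : M -> G) (U : set G) :
  compact K -> compact L -> K `<=` L° -> CL K h -> nbhs (1%g : G) U ->
  exists2 k, CrL r A B L k & forall x, U ((h x)^-1 * k x)%g.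
Proof.
move=> cK cL KL [ch hK] U1.
have h1 x : ~ K x -> h x = 1%g.
  by move=> nKx; apply: contrapT => hx; apply: nKx; apply: hK;
    exact: subset_closure.
have [r0|r0] := pselect (r = Some 0%N).
  exists h; last by move=> x; rewrite mulVg; exact: nbhs_singleton.
  by split; [split => //|move=> x /hK /KL /interior_subset].
have hA' := hA r0.
have [V0 V01 H] := smoothable_compact hF hG hM hlc hA' ch cK KL.
have [|k [ck kU ko ks kK]] := H h ch _ U U1.
  by move=> x; rewrite mulVg; exact: nbhs_singleton.
exists k => //; split.
  apply: (Cr_group_at_map hF hG hA' ck) => x.
  have [Kx|nKx] := pselect (K x); first exact: kK.
  apply: ks; have [_ [_ /(_ 1%g)[psi Bpsi psi1] _ _] _ _] := hG.
  exists psi; split => //; first by rewrite h1.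
  apply: (@Cr_at_near _ _ _ _ _ (fun=> psi 1%g)); last exact: Cr_at_cst.
  have nK : nbhs x (~` K).
    apply: open_nbhs_nbhs; split => //; apply: closed_openC;
      exact: compact_closed.
  by apply: filterS nK => y /h1 /= ->.
rewrite /gsupport; have /closure_id -> : closed L by exact: compact_closed.
apply: closureS => x /= kx; apply: contrapT => nLx; apply: kx.
rewrite ko // h1 // => Kx; apply: nLx; exact: interior_subset (KL _ Kx).
Qed.

Lemma compact_nbhs_compact (K : set M) : compact K ->
  exists2 L, compact L & K `<=` L°.
Proof.
move=> cK; apply: (@compact_ind M (fun D => exists2 L,
  compact L & D `<=` L°) K) => //.
- by exists set0 => //; exact: compact0.
- by move=> D1 D2 D12 [L cL DL]; exists L => // x /D12 /DL.
- move=> D1 D2 [L1 cL1 DL1] [L2 cL2 DL2]; exists (L1 `|` L2);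
  first exact: compactU.
  by move=> x [/DL1|/DL2]; apply: interiorS => y Ly; [left|right].
- move=> x _; have [C [cC _ Cx _]] :=
  compact_nbhs hM hlc (@filterT _ _ (@nbhs_filter M x)).
  by exists C°; [exact: nbhs_interior|exists C].
Qed.

(** [lie_retraction] turns [h] into a map supported in a compact set. One factor of [V * V] inside
    [U] is spent on this, the other on [CrL_approx]. *)
Lemma Crc_approx (h : M -> G) (U : set G) : C0 h -> nbhs (1%g : G) U ->
  exists2 k, Crc r A B k & forall x, U ((h x)^-1 * k x)%g.
Proof.
move=> [ch h0] U1.
have [V V1 VU] := lie_nbhs1_mul hG U1.
have [T [cT T1 TV]] := lie_retraction V1.
have [K cK KT] := h0 _ T1.
have [L cL KL] := compact_nbhs_compact cK.
have Th : CL K (T \o h).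
  split; first exact: comp_continuous.
  rewrite /gsupport; have /closure_id -> : closed K by exact: compact_closed.
  by apply: closureS => x /= Tx; apply: contrapT => /KT.
have [k [kr kL] kV] := CrL_approx cK cL KL Th V1.
exists k; first split => //.
  apply: (subclosed_compact _ cL kL); exact: closed_closure.
by move=> x; have := VU _ _ (TV (h x)) (kV x); rewrite -mulgA mulVKg.
Qed.

End Density.

(** * The topology of the mapping groups *)

Section ShiftChart.
Context {R : realType} {X : topologicalType} {F : tvsType R}.
Variables (psi : chart X F) (oc : open (chart_codom psi)) (c : F).

Let smap x := psi x - c.
Let sinv v := chart_inv psi (v + c).

Let smap_codom v : (smap @` chart_dom psi) v -> chart_codom psi (v + c).
Proof. by move=> [x Ux <-]; exists x => //; rewrite /smap subrK. Qed.

Lemma shift_continuous : continuous (fun v : F => v + c).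
Proof. by move=> v; apply: tvs_cvgD; [exact: cvg_id|exact: cvg_cst]. Qed.

Let smap_open : open (smap @` chart_dom psi).
Proof.
have -> : smap @` chart_dom psi = (fun v => v + c) @^-1` chart_codom psi.
  apply/seteqP; split=> v; first exact: smap_codom.
  by move=> [x Ux xE]; exists x => //; rewrite /smap xE addrK.
by move/continuousP: shift_continuous; apply.
Qed.

Let smap_cont : {within chart_dom psi, continuous smap}.
Proof.
apply/cont_onP => x Ux; have /cont_onP cp := @chart_map_continuous _ _ _ psi.
by apply: tvs_cvgB; [exact: cp|exact: cvg_cst].
Qed.

Let sinv_cont : {within smap @` chart_dom psi, continuous sinv}.
Proof.
apply/cont_onP; have /cont_onP ci := @chart_inv_continuous _ _ _ psi.
apply: (cont_on_comp (f := fun v => v + c)) ci; first exact: smap_codom.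
by apply: continuous_cont_on; exact: shift_continuous.
Qed.

Let smapK x : chart_dom psi x -> sinv (smap x) = x.
Proof. by move=> Ux; rewrite /sinv /smap subrK chart_mapK. Qed.

Let smap_regular : regular_set (smap @` chart_dom psi).
Proof.
move=> v sv; apply: subset_closure; by rewrite ((interior_id _).1 smap_open).
Qed.

Definition shift_chart : chart X F :=
  Chart (@chart_dom_open _ _ _ psi) smap_cont sinv_cont smapK smap_regular.

Lemma shift_chart_codom_open : open (chart_codom shift_chart).
Proof. exact: smap_open. Qed.

End ShiftChart.

Section Mapspace.
Context {R : realType} {F : tvsType R} {G : topGroupType} (B : chart G F ->
  Prop).
Hypothesis hF : hausdorff_space F.
Hypothesis hG : is_lie_group B.

(** With an open codomain the image of the overlap is open, so the interior condition is
    automatic. *)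
Lemma Cr_transition_open (phi psi : chart G F) :
  open (chart_codom psi) ->
  (forall k, Ck k (phi @` (chart_dom phi `&` chart_dom psi)) (psi \o chart_inv
    phi)) ->
  Cr_transition None phi psi.
Proof.
move=> oc tk; split; first by apply/Cr_onP.
have oD : open (psi @` (chart_dom phi `&` chart_dom psi)).
  have [||W oW ->] := @chart_image_open _ _ _ psi (chart_dom phi `&` chart_dom
    psi).
  - by apply: openI; exact: chart_dom_open.
  - by move=> x [].
  - exact: openI.
rewrite ((interior_id _).1 oD) => _ [y /interior_subset [x Dx <-] <-].
by exists x => //=; rewrite chart_mapK //; case: Dx.
Qed.

(* If no chart in [B] were centred at 1, every subset of a [mapspace] would be
   open. *)
Lemma lie_centered_chart :
  exists psi, [/\ B psi, chart_dom psi 1%g & psi 1%g = 0].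
Proof.
have [_ [oB /(_ 1%g)[psi Bpsi psi1] tB mB] _ _] := hG.
have oc := oB _ Bpsi; pose c := psi 1%g.
exists (shift_chart oc c); split => //; last by rewrite /= subrr.
apply: mB; first exact: shift_chart_codom_open.
move=> phi Bphi; split; apply: Cr_transition_open.
- exact: shift_chart_codom_open.
- move=> k /=; have [tk _] := tB _ _ Bphi Bpsi.
  apply: (Ck_add (f := psi \o chart_inv phi) (g := fun=> - c)).
    exact: ((Cr_onP None _ _ hF).1 tk).
  exact: Ck_cst.
- exact: oB.
move=> k /=; have [tk _] := tB _ _ Bpsi Bphi.
have oD : open (psi @` (chart_dom psi `&` chart_dom phi)).
  apply: (lie_chart_open hG Bpsi); last by move=> x [].
  by apply: openI; exact: chart_dom_open.
apply: (Ck_comp (f := fun v => v + c)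
  (D' := psi @` (chart_dom psi `&` chart_dom phi))
  (g := phi \o chart_inv psi)).
- by move=> _ [x Dx <-] /=; rewrite subrK; exists x.
- move=> _ /interior_subset [x Dx <-] /=.
  by rewrite ((interior_id _).1 oD) subrK; exists x.
- apply: (Ck_add (f := id) (g := fun=> c)); last exact: Ck_cst.
  by apply: Ck_linear => // y; exact: cvg_id.
- exact: ((Cr_onP None _ _ hF).1 tk).
Qed.

Context {M : topologicalType}.
Implicit Types X S : set (M -> G).

(** A single chart is enough, one centred at [g], in which [g] becomes the zero function. *)
Lemma mapspace_open_unif X (g : mapspace B X) (O1 : set (mapspace B X)) :
  open O1 -> O1 g -> exists2 U, nbhs (1%g : G) U &
    forall h : mapspace B X, (forall x, U ((sval g x)^-1 * sval h x)%g) -> O1 h.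
Proof.
move=> oO Og; have [psi [Bpsi psi1 psi0]] := lie_centered_chart.
have [W oW WP] := oO g psi Bpsi psi1 psi0.
have W0 : W (psi \o (fun x => ((sval g x)^-1 * sval g x)%g)).
  by apply/(WP g); [move=> x; rewrite mulVg|].
have [Q Q0 QW] := oW _ W0.
exists (chart_dom psi `&` psi @^-1` Q).
  apply: filterI; first by apply: open_nbhs_nbhs; split => //;
    exact: chart_dom_open.
  by apply: chart_continuous => //; rewrite psi0.
move=> h hU; apply/(WP h); first by move=> x; case: (hU x).
by apply: QW => x /=; rewrite mulVg psi0 subr0; case: (hU x).
Qed.

(** Here charts at every [g] must be treated, and closeness in [F] has to yield closeness in [G]
    uniformly over [M]. On a compact set this is [chart_inv_unif]; outside it [k] is near 1, as maps
    in [X] vanish at infinity, and [chart_inv_unif_near] at 1 applies. *)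
Lemma unif_mapspace_open X (O1 : set (mapspace B X)) : X `<=` C0 ->
  (forall h, O1 h -> exists2 V, nbhs (1%g : G) V & forall h' : mapspace B X,
    (forall x, V ((sval h x)^-1 * sval h' x)%g) -> O1 h') -> open O1.
Proof.
move=> XC0 OV; change (mapspace_open O1) => g psi Bpsi psi1 psi0.
(* The functions with a uniform neighbourhood whose members, as far as they come from this chart,
   come from [O1]; splitting [Q] as a sum shows [W] to be open. *)
pose W (v : M -> F) := exists2 Q, nbhs (0 : F) Q &
  forall h : mapspace B X, (forall x,
    chart_dom psi ((sval g x)^-1 * sval h x)%g) ->
    (forall x, Q (psi ((sval g x)^-1 * sval h x)%g - v x)) -> O1 h.
exists W => [v [Q Q0 QO]|h k kU].
  have cD : (fun p : F * F => p.1 + p.2) @ nbhs (0 : F, 0 : F) --> (0 + 0 : F).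
    exact: (@add_continuous F (0, 0)).
  rewrite addr0 in cD; have [[Q1 Q2] /= [Q10 Q20] Q12] := cD _ Q0.
  exists Q2 => // w wv; exists Q1 => // h hd hw; apply: QO => // x.
  have := Q12 (_, _) (conj (hw x) (wv x)).
  by rewrite /= addrA subrK.
split=> [Oh|[Q Q0]]; last first.
  by apply => // x; rewrite /= subrr; exact: nbhs_singleton.
have [V V1 VO] := OV h Oh.
have [ck k0] : C0 k.
  have [[cg g0] [ch h0]] := (XC0 _ (svalP g), XC0 _ (svalP h)).
  split.
    move=> x; apply: (lie_mulg_cvg hG); last exact: ch.
    by apply: (lie_invg_cvg hG); exact: cg.
  move=> U U1; have [U' U'1 U'U] := lie_nbhs1_div hG U1.
  have [[K1 cK1 K1P] [K2 cK2 K2P]] := (g0 _ U'1, h0 _ U'1).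
  exists (K1 `|` K2); first exact: compactU.
  by move=> x nK; apply: U'U; [apply: K1P|apply: K2P] => Kx; apply: nK;
    [left|right].
have [N [Q1 Q10 [N1 NV]]] := chart_inv_unif_near hG Bpsi psi1 V1.
have [K cK KN] := k0 _ N1.
have [Q2 Q20 Q2V] := chart_inv_unif hG Bpsi ck cK (fun x _ => kU x) V1.
exists (Q1 `&` Q2); first exact: filterI.
move=> h' h'd h'Q; apply: VO => x.
have -> : ((sval h x)^-1 * sval h' x = (k x)^-1 * ((sval g x)^-1 * sval h'
  x))%g.
  by rewrite /k invgM invgK -mulgA mulVKg.
rewrite -(chart_mapK (h'd x)); have [q1 q2] := h'Q x.
have cod : chart_codom psi (psi ((sval g x)^-1 * sval h' x)%g)
  by exists ((sval g x)^-1 * sval h' x)%g.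
have [Kx|nKx] := pselect (K x); first exact: Q2V.
by apply: NV => //; exact: KN.
Qed.

Lemma closure_in_unif X S f : X f ->
  (forall U, nbhs (1%g : G) U -> exists2 k, S k /\ X k &
    forall x, U ((f x)^-1 * k x)%g) -> closure_in B X S f.
Proof.
move=> Xf fS; exists (exist _ f Xf) => // N; rewrite nbhsE => -[N0 [oO Of] ON].
have [U U1 UO] := mapspace_open_unif oO Of.
have [k [Sk Xk] kU] := fS U U1.
exists (exist _ k Xk); split => //; apply: ON; exact: UO.
Qed.

(** The maps that are [U]-close to [h] need not form an open set; [near_h] is the interior for
    uniform closeness, open by [unif_mapspace_open]. *)
Lemma closure_inP X S f : X `<=` C0 -> closure_in B X S f ->
  X f /\ forall U, nbhs (1%g : G) U ->
    exists2 k, S k & forall x, U ((f x)^-1 * k x)%g.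
Proof.
move=> XC0 [h clh <-]; split=> [|U U1]; first exact: svalP h.
pose near_h (h1 : mapspace B X) := exists2 V, nbhs (1%g : G) V &
  forall h' : mapspace B X, (forall x, V ((sval h1 x)^-1 * sval h' x)%g) ->
    forall x, U ((sval h x)^-1 * sval h' x)%g.
have oN : open (near_h : set (mapspace B X)).
  apply: unif_mapspace_open => // h1 [V V1 VU].
  have [V' V'1 V'V] := lie_nbhs1_mul hG V1.
  exists V' => // h2 h12; exists V' => // h3 h23; apply: VU => x.
  by have := V'V _ _ (h12 x) (h23 x); rewrite -mulgA mulVKg.
have Nh : near_h h by exists U.
have [k [Sk [V V1 VU]]] := clh _ (open_nbhs_nbhs (conj oN Nh)).
exists (sval k) => //; apply: VU => x.
by rewrite mulVg; exact: nbhs_singleton.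
Qed.

End Mapspace.

Theorem proposition10p12 (R : realType) (F : tvsType R) (G : topGroupType)
    (B : chart G F -> Prop) (r : option nat)
    (M : topologicalType) (A : rough_chart R M -> Prop)
    (hF : hausdorff_space F) (hG : is_lie_group B)
    (hM : hausdorff_space M) (hlc : locally_compact [set: M])
    (hA : r <> Some 0%N -> is_rough_manifold r A) :
  (forall K L : set M, compact K -> compact L -> K `<=` L° ->
     CL K `<=` closure_in B C0 (CrL r A B L) /\
     closure_in B C0 (CrL r A B L) = closure_in B (CL L) (CrL r A B L)) /\
  dense [set h : mapspace B C0 | Crc r A B (sval h)].
Proof.
have CL_C0 (L : set M) : compact L -> CL L `<=` (C0 : set (M -> G)).
  move=> cL f [cf fL]; split => // U U1; exists L => // x nLx.
  suff -> : f x = 1%g by exact: nbhs_singleton.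
  by apply: contrapT => fx; apply: nLx; apply: fL; exact: subset_closure.
split=> [K L cK cL KL|].
  have CrL_CL : CrL r A B L `<=` CL L by move=> f [[cf _] fL].
  have CLL := CL_C0 L cL; split=> [f Kf|].
    apply: (closure_in_unif hF hG); first exact: CL_C0 cK _ Kf.
    move=> U U1; have [k kr kU] := CrL_approx hF hG hM hlc hA cK cL KL Kf U1.
    by exists k => //; split => //; apply: CLL; exact: CrL_CL.
  (* Both closures amount to uniform approximability; what remains is that a limit taken in [C0] has
     support in [L]. *)
  apply/seteqP; split=> f clf.
    have [[cf _] fS] := closure_inP hG (@subset_refl _ _) clf.
    apply: (closure_in_unif hF hG) => [|U U1]; last first.
      have [k kr kU] := fS U U1.
      by exists k => //; split => //; exact: CrL_CL.
    split => //; have /closure_id -> : closed L by exact: compact_closed.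
    apply: closureS => x /= fx; apply: contrapT => nLx.
    have [hsG _ _ _] := hG.
    (* If [f x] were not 1 at some [x] outside [L], then, every [k] in [CrL] being 1 at [x], no such
       [k] would be close to [f] with respect to a neighbourhood of 1 that omits [(f x)^-1]. *)
    have nU : nbhs (1%g : G) (~` [set (f x)^-1%g]).
      apply: open_nbhs_nbhs; split.
        apply: closed_openC; apply: accessible_closed_set1.
        exact: hausdorff_accessible.
      by move=> /= f1; apply: fx; rewrite -[f x]invgK -f1 invg1.
    have [k [_ kL] kU] := fS _ nU.
    apply: (kU x); rewrite /= [k x](_ : _ = 1%g) ?mulg1 //.
    by apply: contrapT => kx; apply: nLx; apply: kL; exact: subset_closure.
  have [fL fS] := closure_inP hG CLL clf.
  apply: (closure_in_unif hF hG) => [|U U1]; first exact: CLL.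
  have [k kr kU] := fS U U1; exists k => //; split => //.
  by apply: CLL; exact: CrL_CL.
move=> N [h Nh] oN; have [U U1 UN] := mapspace_open_unif hF hG oN Nh.
have [k [kr kc] kU] := Crc_approx hF hG hM hlc hA (svalP h) U1.
have k0 : C0 k by apply: (CL_C0 _ kc); split => //; case: kr.
by exists (exist _ k k0); split => //; exact: UN.
Qed.
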